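(* Let $T$ be an infinite undirected tree which is transient for simple random walk and which has no vertex of degree $2$, and let $T'$ be a bounded subdivision of $T$. Then the loop contracting random walk (LCRW) on $T'$ is transient at every vertex of $T'$ almost surely.
   Context: Graphs are locally finite, connected multigraphs without self-loops; $\vec E$ denotes the set of oriented edges (both orientations of each edge), $\vec e_-$ the tail and $\vec e_+$ the head of $\vec e$. A subdivision of a graph replaces each edge by a path of finite length; it is bounded if these lengths are uniformly bounded. Contraction: given a (multi)graph and an oriented cycle $C$ in it, contracting $C$ means removing all vertices of $C$ and all oriented edges with both endpoints among the vertices of $C$, adding a new vertex $v_C$, and replacing every oriented edge having exactly one endpoint among the vertices of $C$ by the oriented edge obtained by replacing that endpoint by $v_C$ (orientation and other endpoint unchanged). Oriented edges of a contracted graph are thereby identified with oriented edges of the original graph. LCRW on an infinite graph $G$ started at $x$: a random sequence $(G_i,P_i,X_i)_{i\ge0}$ where $G_i$ is a multigraph obtained from $G$ by successive contractions, $X_i$ a vertex of $G_i$, and $P_i$ a simple oriented path in $G_i$ from (the vertex containing) $x$ to $X_i$. Start with $G_0=G$, $P_0$ the empty path at $x$, $X_0=x$. Given step $i$, choose an oriented edge $\vec e$ uniformly at random (counting multiplicity, independently of the past) among the outgoing edges of $X_i$ in $G_i$. If $\vec e_+$ is a vertex $y$ of $P_i$ (possibly its starting vertex), let $C$ be the cycle formed by the portion of $P_i$ from $y$ to $X_i$ followed by $\vec e$; let $G_{i+1}$ be $G_i$ with $C$ contracted, $P_{i+1}$ the portion of $P_i$ from its start to $y$ (now ending at the new vertex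 $v_C$), and $X_{i+1}=v_C$. Otherwise $G_{i+1}=G_i$, $P_{i+1}$ is $P_i$ extended by $\vec e$, and $X_{i+1}=\vec e_+$. The LCRW is transient at $x$ if, almost surely, $P_i$ converges to an infinite path as $i\to\infty$ (every initial segment of $P_i$, viewed as a path of oriented edges of $G$, is eventually constant and the length of $P_i$ tends to infinity). *)

(* Defs.v *)
From HB Require Import structures.
From mathcomp Require Import all_boot all_order all_algebra.
From mathcomp Require Import all_classical all_reals all_analysis.

Set Implicit Arguments.
Unset Strict Implicit.
Unset Printing Implicit Defensive.
Import Order.TTheory GRing.Theory Num.Theory.

Section Graphs.
Variable V : countType.
Variable nb : V -> seq V.

Definition adj : rel V := fun a b => b \in nb a.

Definition deg (v : V) : nat := size (nb v).

Definition connected_graph : Prop :=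
  forall x y : V, exists p : seq V, path adj x p /\ last x p = y.

Definition lf_graph : Prop :=
  [/\ forall x, uniq (nb x),
      forall x, x \notin nb x,
      forall x y, y \in nb x -> x \in nb y
    & connected_graph].

Definition infinite_vertex_set : Prop :=
  forall s : seq V, exists v : V, v \notin s.

Definition acyclic : Prop :=
  forall (x : V) (p : seq V),
    ~ [/\ 3 <= size (x :: p), uniq (x :: p), path adj x p & adj (last x p) x].

Definition is_tree : Prop := lf_graph /\ acyclic.

Variable R : realType.

(* hit_first t n y = probability that SRW started at y is at t at time n     *)
(* for the first time (time 0 included).                                      *)
Fixpoint hit_first (t : V) (n : nat) (y : V) : R :=
  match n with
  | 0 => if y == t then 1%R else 0%R
  | n'.+1 => if y == t then 0%R
             else ((deg y)%:R^-1 * \sum_(z <- nb y) hit_first t n' z)%R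
  end.

(* probability that SRW started at x first returns to x at time n+1 *)
Definition first_return (x : V) (n : nat) : R :=
  ((deg x)%:R^-1 * \sum_(z <- nb x) hit_first x n z)%R.

Definition srw_transient_at (x : V) : Prop :=
  (\sum_(n <oo) (first_return x n)%:E < 1)%E.

(* the graph is transient (for a connected graph, at some iff at every vertex) *)
Definition srw_transient : Prop := exists x : V, srw_transient_at x.

End Graphs.

Definition consecutive (T : eqType) (a b : T) (s : seq T) : bool :=
  (a, b) \in zip s (behead s).

(* T' = (V', nb') is obtained from T = (V, nb) by replacing every edge uv by  *)
(* the path  io u, p u v, io v  (p u v = the new internal vertices).          *)
Definition subdivision_data (V V' : countType) (nb : V -> seq V) (nb' : V' -> seq V')
    (io : V -> V') (p : V -> V -> seq V') : Prop :=
  [/\ injective io,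
      (forall u v, v \in nb u -> p v u = rev (p u v)),
      (forall u v, v \in nb u -> path (adj nb') (io u) (rcons (p u v) (io v)))
    & (forall u v, v \in nb u -> uniq (p u v))] /\
  [/\ (forall u v a, v \in nb u -> a \in p u v -> forall w, a != io w),
      (forall u v u' v' a, v \in nb u -> v' \in nb u' -> a \in p u v -> a \in p u' v' ->
         (u' = u /\ v' = v) \/ (u' = v /\ v' = u)),
      (forall a : V', (exists w, a = io w) \/ (exists u v, v \in nb u /\ a \in p u v))
    & (forall a b : V', b \in nb' a ->
         exists u v, v \in nb u /\ consecutive a b (io u :: rcons (p u v) (io v)))].

Definition bounded_subdivision (V V' : countType) (nb : V -> seq V) (nb' : V' -> seq V') : Prop :=
  exists (io : V -> V') (p : V -> V -> seq V'),
    subdivision_data nb nb' io p /\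
    exists L : nat, forall u v, v \in nb u -> size (p u v) <= L.

(* The contracted graph G_i is determined by the partition of V into classes: *)
(* its vertices are the classes, its oriented edges are the oriented edges    *)
(* (u,w) of G whose endpoints lie in different classes.  All non-singleton    *)
(* classes lie on the current path P_i, so a state is the path P_i, stored as *)
(* its first vertex (a class) and the list of its oriented edges, each paired *)
(* with (the class of) its head vertex.                                       *)
Section LCRW.
Local Open Scope classical_set_scope.
Variable V : countType.
Variable nb : V -> seq V.

Definition lstate : Type := (seq V * seq ((V * V) * seq V))%type.

Definition lstart (x : V) : lstate := ([:: x], [::]).

Definition path_classes (st : lstate) : seq (seq V) := st.1 :: map snd st.2.

Definition path_edges (st : lstate) : seq (V * V) := map fst st.2.

Definition cur (st : lstate) : seq V := last st.1 (map snd st.2).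

Definition out_edges (X : seq V) : seq (V * V) :=
  [seq (u, w) | u <- X, w <- [seq w <- nb u | w \notin X]].

Definition lstep (st : lstate) (e : V * V) : lstate :=
  if e \in out_edges (cur st) then
    let cs := path_classes st in
    let j := find (fun c => e.2 \in c) cs in
    if j < size cs then
      (* e_+ = y is the j-th vertex of P_i: contract the cycle *)
      if j == 0 then (flatten cs, [::])
      else (st.1, rcons (take j.-1 st.2)
                        ((nth (e, [::]) st.2 j.-1).1, flatten (drop j cs)))
    else (st.1, rcons st.2 (e, [:: e.2]))
  else st.

Definition lrun (x : V) (h : seq (V * V)) : lstate := foldl lstep (lstart x) h.

Definition lchoice_prob (R : realType) (x : V) (h : seq (V * V)) (e : V * V) : R :=
  let o := out_edges (cur (lrun x h)) in
  if e \in o then ((size o)%:R^-1)%R else 0%R.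

(* c n w = the oriented edge chosen at step n *)
Definition history (Omega : Type) (c : nat -> Omega -> V * V) (n : nat) (w : Omega)
  : seq (V * V) := [seq c i w | i <- iota 0 n].

Definition is_lcrw (d : measure_display) (Omega : measurableType d) (R : realType)
    (P : probability Omega R) (x : V) (c : nat -> Omega -> V * V) : Prop :=
  (forall n (e : V * V), measurable [set w | c n w = e]) /\
  (forall n (h : seq (V * V)) (e : V * V), size h = n ->
     P [set w | history c n w = h /\ c n w = e] =
     (P [set w | history c n w = h] * (lchoice_prob R x h e)%:E)%E).

Definition path_converges (Ps : nat -> seq (V * V)) : Prop :=
  forall k : nat, exists N : nat, forall i, N <= i ->
    take k (Ps i) = take k (Ps N) /\ k <= size (Ps i).

Definition lcrw_transient_at (x : V) : Prop :=
  forall (d : measure_display) (Omega : measurableType d) (R : realType)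
         (P : probability Omega R) (c : nat -> Omega -> V * V),
    is_lcrw P x c ->
    {ae P, forall w, path_converges (fun i => path_edges (lrun x (history c i w)))}.

End LCRW.

(* Main.v *)
Require Import Defs.
From HB Require Import structures.
From mathcomp Require Import all_boot all_order all_algebra.
From mathcomp Require Import all_classical all_reals all_analysis.
From mathcomp Require Import ring lra.

(** On a tree every contracted cycle is an edge traversed back and forth, so the LCRW
    only depends on the stack of the sets of unexplored edges leaving the classes of
    the current path: the top class either crosses one of its unexplored edges (push)
    or merges into the previous class (pop).  Suppose that the class at some level of
    the stack is exposed infinitely often.  Seen from that level, an excursion through
    an edge f never returns with probability q(f), and the flux Q, the sum of the q(f)
    over the boundary of the class, is a supermartingale.  If the class is killed at
    rate a at each exposure, it survives with probability at most 2Q/a: by the product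
    structure of the tree survival is subadditive over boundary edges, and for a single
    edge one compares the rate-a clock with the rate-1 clock of the edge leading back.
    Convexity in a then shows that for a positive killing rate infinitely many exposures
    without killing have probability zero.  This settles all levels but the root, where
    leading back is not possible; there one lets the rate tend to 0, the killing
    probability being at most a/(a + C) with C the effective conductance to infinity,
    because the hitting probability of simple random walk on the contracted network is
    a supermartingale for the LCRW.  No positive conductance is lost when passing from
    the tree to a bounded subdivision. *)

Set Implicit Arguments.
Unset Strict Implicit.
Unset Printing Implicit Defensive.
Import Order.TTheory GRing.Theory Num.Theory.
Import numFieldNormedType.Exports.

(** * Stacks of boundaries *)

Lemma rem_cat (E : eqType) (f : E) F G : f \in F -> rem f (F ++ G) = rem f F ++ G.
Proof.
elim: F => //= x F IH; rewrite inE eq_sym.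
by case: eqP => //= _ fF; rewrite IH.
Qed.

Lemma perm_rem (E : eqType) (f : E) F G : perm_eq F G -> perm_eq (rem f F) (rem f G).
Proof.
move=> FG; case: (boolP (f \in F)) => fF; last first.
  by rewrite !rem_id// -(perm_mem FG).
have fG : f \in G by rewrite -(perm_mem FG).
rewrite -(perm_cons f) perm_sym; apply: perm_trans (perm_to_rem fF).
by rewrite perm_sym; apply: perm_trans FG (perm_to_rem fG).
Qed.

Section Stack.
Local Open Scope classical_set_scope.
Local Open Scope ring_scope.
Variables (R : realType) (E : eqType) (ch : E -> seq E).
Implicit Types (a : R) (phi psi : seq (seq E) -> R) (s t : seq (seq E)) (F G H : seq E).

(** * The walk on stacks and its killing probability *)

Definition pop G s := if s is H :: t then (G ++ H) :: t else [::].
Definition push f G s := ch f :: rem f G :: s.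
Definition wt a s := if s is [::] then a else 1.

(* The head of a stack is the top class, given by its unexplored edges.  Every class
   has one edge leading back except the last one, the root, which is killed at rate
   [a]; the empty stack is the killed (absorbing) state. *)
Definition stepop a phi s : R :=
  if s is G :: t then
    (wt a t * phi (pop G t) + \sum_(g <- G) phi (push g G t)) / ((size G)%:R + wt a t)
  else phi [::].

Definition kill a n := iter n (stepop a) (fun s => (s == [::])%:R).

Lemma wt_ge0 a s : 0 <= a -> 0 <= wt a s.
Proof. by case: s. Qed.

Lemma denom_ge0 a G s : 0 <= a -> 0 <= (size G)%:R + wt a s.
Proof. by move=> a0; rewrite addr_ge0// wt_ge0. Qed.

Lemma stepop_le a phi psi s : 0 <= a -> (forall t, phi t <= psi t) ->
  stepop a phi s <= stepop a psi s.
Proof.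
move=> a0 h; case: s => [|G s] //=.
rewrite ler_wpM2r ?invr_ge0 ?denom_ge0//.
by rewrite lerD ?ler_sum// ler_wpM2l ?wt_ge0.
Qed.

Lemma stepop_ext a phi psi s : phi =1 psi -> stepop a phi s = stepop a psi s.
Proof. by move=> /funext ->. Qed.

Lemma stepopD a phi psi s :
  stepop a (fun t => phi t + psi t) s = stepop a phi s + stepop a psi s.
Proof. by case: s => [|G s] //=; rewrite big_split/=; ring. Qed.

Lemma stepopZ a c phi s : stepop a (fun t => c * phi t) s = c * stepop a phi s.
Proof. by case: s => [|G s] //=; rewrite -mulr_sumr; ring. Qed.

Lemma stepop_ge0 a phi s : 0 <= a -> (forall t, 0 <= phi t) -> 0 <= stepop a phi s.
Proof.
move=> a0 h; case: s => [|G s] //=.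
rewrite divr_ge0 ?denom_ge0// addr_ge0 ?sumr_ge0// mulr_ge0 ?wt_ge0//.
Qed.

Lemma stepop_le1 a phi s : 0 <= a -> (forall t, phi t <= 1) -> stepop a phi s <= 1.
Proof.
move=> a0 h; case: s => [|G s] //=.
have := denom_ge0 G s a0; rewrite le_eqVlt => /orP[/eqP <-|d0].
  (* At rate 0 a root without edges divides by 0, and the quotient is 0 by convention. *)
  by rewrite invr0 mulr0.
rewrite ler_pdivrMr// mul1r addrC lerD//.
  by rewrite -sum1_size natr_sum ler_sum.
by rewrite -[leRHS]mulr1 ler_wpM2l// wt_ge0.
Qed.

Lemma stepop_cvg a (u : nat -> seq (seq E) -> R) phi s :
  (forall t, u n t @[n --> \oo] --> phi t) ->
  stepop a (u n) s @[n --> \oo] --> stepop a phi s.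
Proof.
move=> h; case: s => [|G s] /=; first exact: h.
apply: cvgM; last exact: cvg_cst.
apply: cvgD; first by apply: cvgM; [exact: cvg_cst | exact: h].
have hs L : (\sum_(g <- L) u n (push g G s)) @[n --> \oo] --> \sum_(g <- L) phi (push g G s).
  elim: L => [|g L IH].
    under eq_fun do rewrite big_nil.
    by rewrite big_nil; exact: cvg_cst.
  under eq_fun do rewrite big_cons.
  by rewrite big_cons; apply: cvgD; [exact: h|exact: IH].
exact: hs.
Qed.

Lemma kill_ge0 a n s : 0 <= a -> 0 <= kill a n s.
Proof. by move=> a0; elim: n s => [|n IH] s //=; apply: stepop_ge0. Qed.

Lemma kill_le1 a n s : 0 <= a -> kill a n s <= 1.
Proof.
move=> a0; elim: n s => [|n IH] s /=; first by case: eqP.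
exact: stepop_le1.
Qed.

Lemma kill_nil a n : kill a n [::] = 1.
Proof. by elim: n => [|n IH] /=. Qed.

Lemma kill_le a s : 0 <= a -> nondecreasing_seq (fun n => kill a n s).
Proof.
move=> a0; apply/nondecreasing_seqP => n.
elim: n s => [|n IH] s; last exact: stepop_le.
by case: s => [|G s] //; apply: kill_ge0.
Qed.

Definition kill_lim a s : R := limn (fun n => kill a n s).

Lemma kill_lim_cvg a s : 0 <= a -> kill a n s @[n --> \oo] --> kill_lim a s.
Proof.
move=> a0; apply: nondecreasing_is_cvgn; first exact: kill_le.
by exists 1 => _ [n _ <-]; apply: kill_le1.
Qed.

Lemma kill_le_lim a n s : 0 <= a -> kill a n s <= kill_lim a s.
Proof.
move=> a0; apply: (@nondecreasing_cvgn_le _ (fun n => kill a n s)); first exact: kill_le.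
by apply: cvgP; apply: kill_lim_cvg.
Qed.

Lemma kill_lim_ge0 a s : 0 <= a -> 0 <= kill_lim a s.
Proof. by move=> a0; apply: le_trans (kill_le_lim 0 s a0); rewrite /=; case: eqP. Qed.

Lemma kill_lim_lim_le a s y : 0 <= a -> (forall n, kill a n s <= y) -> kill_lim a s <= y.
Proof.
move=> a0 h; apply: limr_le; first by apply: cvgP; apply: kill_lim_cvg.
by near=> n; apply: h.
Unshelve. all: by end_near. Qed.

Lemma kill_lim_le1 a s : 0 <= a -> kill_lim a s <= 1.
Proof. by move=> a0; apply: kill_lim_lim_le => // n; apply: kill_le1. Qed.

Lemma kill_lim_nil a : 0 <= a -> kill_lim a [::] = 1.
Proof.
move=> a0; apply/eqP; rewrite eq_le kill_lim_le1//=.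
by rewrite -(kill_nil a 0) kill_le_lim.
Qed.

Lemma kill_lim_fix a s : 0 <= a -> stepop a (kill_lim a) s = kill_lim a s.
Proof.
move=> a0; have h1 : stepop a (kill a n) s @[n --> \oo] --> stepop a (kill_lim a) s.
  by apply: stepop_cvg => t; apply: kill_lim_cvg.
have h2 : kill a n.+1 s @[n --> \oo] --> kill_lim a s.
  by rewrite (cvg_shiftS (fun n => kill a n s)); apply: kill_lim_cvg.
by apply: cvg_unique h1 h2.
Qed.

(** By induction on [n], killing within [n] steps stays below any such supersolution. This is the
    comparison principle used with explicit supersolutions below. *)
Lemma kill_lim_min a psi s : 0 <= a -> 1 <= psi [::] -> (forall t, 0 <= psi t) ->
  (forall t, stepop a psi t <= psi t) -> kill_lim a s <= psi s.
Proof.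
move=> a0 h1 h0 h; apply: kill_lim_lim_le => // n.
elim: n s => [|n IH] s /=; first by case: s.
by apply: le_trans (h s); apply: stepop_le.
Qed.

(** Same stack as [pop G (rcons s F)], by cases on [s]: above a root [F] the edge leading back has
    weight 1 for every rate. *)
Definition popr G s F := if s is H :: t then rcons ((G ++ H) :: t) F else [:: G ++ F].

Lemma stepop_rcons a phi G s F :
  stepop a phi (G :: rcons s F) =
  (phi (popr G s F) + \sum_(g <- G) phi (rcons (push g G s) F)) / ((size G)%:R + 1).
Proof. by case: s => [|H s]; rewrite /= ?mul1r. Qed.

(** At rate 1 the root of a stack behaves like any other class, so [kill_lim 1 s] is the probability
    of ever returning to the level below [s]. *)
Lemma stepop1 phi G s :
  stepop 1 phi (G :: s) = (phi (pop G s) + \sum_(g <- G) phi (push g G s)) / ((size G)%:R + 1).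
Proof. by case: s => [|H s]; rewrite /= mul1r. Qed.

Lemma stepop_root a phi F :
  stepop a phi [:: F] = (a * phi [::] + \sum_(f <- F) phi [:: ch f; rem f F]) / ((size F)%:R + a).
Proof. by []. Qed.

(** * Survival at the root: subadditivity and the flux bound *)

Definition perms s t := all2 perm_eq s t.

Lemma kill_perm a n s t : perms s t -> kill a n s = kill a n t.
Proof.
elim: n s t => [|n IH] [|F s] [|G t] //= /andP[FG st].
rewrite (perm_size FG); congr (_ / _); last by case: s t st => [|? ?] [|? ?].
congr (_ + _).
  congr (_ * _); first by case: s t st => [|? ?] [|? ?].
  apply: IH; case: s t st => [|H s] [|K t] //= /andP[HK ->].
  by rewrite perm_cat.
rewrite (perm_big _ FG)/=; apply: eq_bigr => f _; apply: IH.
by rewrite /= perm_refl st perm_rem.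
Qed.

(* The only place where the product structure of the tree (independence of the parts
   behind distinct boundary edges) enters. *)
Lemma kill_mul a m n s F G : 0 < a ->
  kill a m (rcons s F) * kill a n [:: G] <= kill a (m + n) (rcons s (F ++ G)).
Proof.
move=> a0; have a0' := ltW a0.
have [k] := ubnP (m + n); elim: k m n s F G => // k IH m n s F G.
rewrite ltnS => mnk.
case: m mnk => [|m] mnk.
  by rewrite add0n /= (_ : (rcons s F == [::]) = false) ?mul0r ?kill_ge0//; case: s.
case: n mnk => [|n] mnk; first by rewrite mulr0 kill_ge0.
(* Above the root both sides make the same step, and the induction hypothesis applies term by
   term. *)
case: s => [|H s]; last first.
  rewrite rcons_cons addSn [kill a m.+1 _]/kill iterS -/(kill a m).
  rewrite [kill a (m + _).+1 _]/kill iterS -/(kill a _) !stepop_rcons.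
  rewrite mulrAC ler_wpM2r ?invr_ge0 ?addr_ge0// mulrDl lerD//.
    case: s => [|K s]; rewrite /popr ?catA; first by apply: (IH m n.+1 [::]).
    by apply: (IH _ _ ((H ++ K) :: s)).
  by rewrite mulr_suml ler_sum// => h _; apply: IH.
have D0 (L : seq E) : (size L)%:R + a != 0 by rewrite lt0r_neq0// ltr_wpDl.
set x := kill a m.+1 _; set y := kill a n.+1 _.
have xE : x * ((size F)%:R + a) = a + \sum_(f <- F) kill a m [:: ch f; rem f F].
  by rewrite /x /= kill_nil mulr1 divfK.
have yE : y * ((size G)%:R + a) = a + \sum_(f <- G) kill a n [:: ch f; rem f G].
  by rewrite /y /= kill_nil mulr1 divfK.
rewrite addSn /= kill_nil mulr1 ler_pdivlMr; last by rewrite ltr_wpDl.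
rewrite big_cat size_cat natrD/=.
have hF : (x * ((size F)%:R + a) - a) * y <=
    \sum_(f <- F) kill a (m + n.+1) [:: ch f; rem f (F ++ G)].
  rewrite xE addrC addKr mulr_suml !big_seq ler_sum// => f fF.
  rewrite (_ : rem f (F ++ G) = rem f F ++ G); last by rewrite rem_cat.
  by apply: (IH m n.+1 [:: ch f]).
have hG : (y * ((size G)%:R + a) - a) * x <=
    \sum_(f <- G) kill a (m + n.+1) [:: ch f; rem f (F ++ G)].
  rewrite yE addrC addKr mulr_suml !big_seq ler_sum// => f fG.
  rewrite (@kill_perm a (m + n.+1) _ [:: ch f; rem f G ++ F]); last first.
    rewrite /= perm_refl/= andbT.
    rewrite -rem_cat//; apply: perm_rem.
    by rewrite perm_catC.
  rewrite addnS -addSn addnC; apply: (IH n m.+1 [:: ch f]).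
  by rewrite addnC addSn -addnS.
(* Adding [hF] and [hG] leaves [a * (x + y - x * y)] on the right; this nonnegative term is its
   distance from [a]. *)
have xy : 0 <= a * ((1 - x) * (1 - y)).
  by rewrite !mulr_ge0// subr_ge0 kill_le1.
lra.
Qed.

(** Probability that an excursion through [f] never returns: behind [f] the walk starts from the
    single class [ch f], whose way back is the killing. *)
Definition esc f := 1 - kill_lim 1 [:: ch f].
Definition flux F := \sum_(f <- F) esc f.

Lemma esc_ge0 f : 0 <= esc f.
Proof. by rewrite subr_ge0 kill_lim_le1. Qed.

Lemma flux_ge0 F : 0 <= flux F.
Proof. by apply: sumr_ge0 => f _; apply: esc_ge0. Qed.

Lemma flux_cat F G : flux (F ++ G) = flux F + flux G.
Proof. by rewrite /flux big_cat. Qed.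

Lemma flux_rem f F : f \in F -> flux F = esc f + flux (rem f F).
Proof. by move=> fF; rewrite /flux (perm_big _ (perm_to_rem fF)) big_cons. Qed.

Lemma kill_lim_mul a F G : 0 < a -> kill_lim a [:: F] * kill_lim a [:: G] <= kill_lim a [:: F ++ G].
Proof.
move=> a0; have a0' := ltW a0.
have h : kill a n [:: F] * kill a n [:: G] @[n --> \oo] --> kill_lim a [:: F] * kill_lim a [:: G].
  by apply: cvgM; apply: kill_lim_cvg.
rewrite -(cvg_lim _ h)//; apply: limr_le; first by apply: cvgP h.
near=> n; apply: le_trans (kill_le_lim (n + n) _ a0').
by apply: (@kill_mul a n n [::]).
Unshelve. all: by end_near. Qed.

Lemma kill_lim_root0 a : 0 < a -> kill_lim a [:: [::]] = 1.
Proof.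
move=> a0; rewrite -kill_lim_fix ?ltW//= big_nil kill_lim_nil ?ltW// mulr1 addr0 add0r.
by rewrite divff ?lt0r_neq0.
Qed.

(* A clock of rate 1 followed by one of rate a: from the stack extended by an empty
   root of rate a, the rate-1 killing of s is merely the return to that root. *)
Lemma kill_lim_rcons0 a s : 1 < a ->
  a * kill_lim 1 s <= kill_lim a s + (a - 1) * kill_lim a (rcons s [::]).
Proof.
move=> a1; have a0 : 0 < a by lra.
have a0' := ltW a0.
rewrite mulrC -ler_pdivlMr//.
(* A supersolution for rate 1. At the empty stack it is 1, and at a single class with d edges it is
   an equality because [1 + (a - 1) / (d + 1) = (d + a) / (d + 1)]. *)
pose psi t := (kill_lim a t + (a - 1) * kill_lim a (rcons t [::])) / a.
have psiE t : psi t = a^-1 * kill_lim a t + (a - 1) / a * kill_lim a (rcons t [::]).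
  by rewrite /psi; field; rewrite lt0r_neq0.
apply: (@kill_lim_min 1 psi) => //.
- rewrite /psi kill_lim_nil// kill_lim_root0// mulr1 subrKC divff ?lt0r_neq0//.
- move=> t; rewrite divr_ge0// addr_ge0 ?kill_lim_ge0// mulr_ge0 ?kill_lim_ge0//; lra.
case=> [|G t]; first exact: lexx.
rewrite (stepop_ext _ _ psiE) stepopD !stepopZ psiE.
have -> : kill_lim a (rcons (G :: t) [::]) = stepop a (kill_lim a) (G :: rcons t [::]) by rewrite kill_lim_fix.
rewrite -[X in _ <= _ * X + _](kill_lim_fix _ a0') stepop_rcons.
case: t => [|H t]; last first.
  by rewrite !stepop1 /= !mul1r.
rewrite !stepop1 /= cats0 !kill_lim_nil//.
rewrite kill_lim_root0// mulr1.
set S := \sum_(g <- G) kill_lim a (push g G [::]).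
set S' := \sum_(g <- G) kill_lim a [:: _, _ & _].
have D1 : (size G)%:R + 1 != 0 :> R by rewrite lt0r_neq0// ltr_wpDl.
have D2 : (size G)%:R + a != 0 :> R by rewrite lt0r_neq0// ltr_wpDl.
have -> : kill_lim a [:: G] = (a + S) / ((size G)%:R + a).
  by rewrite -kill_lim_fix//= kill_lim_nil// mulr1.
rewrite le_eqVlt; apply/orP; left; apply/eqP.
field.
by rewrite D1 D2 lt0r_neq0.
Qed.

(** A single edge is treated by the two clocks of [kill_lim_rcons0], several edges by subadditivity
    of survival, from [kill_lim_mul]. *)
Lemma kill_lim_root_ge a F : 2 <= a -> 1 <= kill_lim a [:: F] + 2 / a * flux F.
Proof.
move=> a2; have a0 : 0 < a by lra.
have a0' := ltW a0.
have h1 f : 1 - kill_lim a [:: [:: f]] <= 2 / a * esc f.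
  rewrite -kill_lim_fix//= big_seq1 kill_lim_nil// /push /= eqxx mulr1.
  have a1 : 1 < a by lra.
  have := kill_lim_rcons0 [:: ch f] a1.
  rewrite /esc /=.
  have := @kill_lim_le1 a [:: ch f] a0'.
  have := @kill_lim_le1 a [:: ch f; [::]] a0'.
  set x := kill_lim a [:: _; _]; set y := kill_lim a _; set z := kill_lim 1 _ => hx hy hz.
  have hz1 : 0 <= 1 - z by rewrite subr_ge0 kill_lim_le1.
  (* Here [y] is bounded by 1. The resulting factor [a / (a^2 - 1)] is at most [2 / a] as soon as
     [a^2] is at least 2, hence the constant 2. *)
  have h : (a - 1) * (1 - x) <= a * (1 - z) by lra.
  have -> : 1 - (a + x) / (1 + a) = (1 - x) / (1 + a).
    by field; rewrite lt0r_neq0//; lra.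
  rewrite ler_pdivrMr; last by lra.
  have a10 : 0 < a - 1 by lra.
  rewrite -(ler_pM2l a10); apply: (le_trans h).
  move: hz1; move: (1 - z) => w w0.
  rewrite -(ler_pM2l a0).
  have -> : a * ((a - 1) * (2 / a * w * (1 + a))) = 2 * (a ^+ 2 - 1) * w.
    by field; rewrite lt0r_neq0.
  rewrite mulrA; apply: ler_wpM2r => //; nra.
elim: F => [|f F IH]; first by rewrite /flux big_nil mulr0 addr0 kill_lim_root0.
have := @kill_lim_mul a [:: f] F a0; rewrite /= => hm.
rewrite /flux big_cons -/(flux F) mulrDr.
have := h1 f; have := @kill_lim_le1 a [:: [:: f]] a0'; have := @kill_lim_le1 a [:: F] a0'.
move: hm IH; move: (kill_lim a [:: [:: f]]) (kill_lim a [:: F]) (kill_lim a [:: f :: F]).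
move: (2 / a * esc f) (2 / a * flux F) => u v x y z *.
(* Uses [x * y >= x + y - 1], as both are at most 1. *)
nra.
Qed.

(** * Exposures of the root and the flux supermartingale *)

(* Probability of ever exposing the root level of the stack. *)
Definition expose s := if s is G :: t then kill_lim 1 (belast G t) else 0.

Lemma expose_rcons s F : expose (rcons s F) = kill_lim 1 s.
Proof. by case: s => [|G s] //=; rewrite belast_rcons. Qed.

Lemma expose_ge0 s : 0 <= expose s.
Proof. by case: s => [|G s] //=; rewrite kill_lim_ge0. Qed.

Lemma expose_le1 s : expose s <= 1.
Proof. by case: s => [|G s] //=; rewrite kill_lim_le1. Qed.

Lemma stepop_expose a G s F : stepop a expose (G :: rcons s F) = kill_lim 1 (G :: s).
Proof.
rewrite stepop_rcons -kill_lim_fix// stepop1; congr (_ / _); congr (_ + _).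
  by case: s => [|H s] //=; rewrite belast_rcons.
by apply: eq_bigr => g _; rewrite expose_rcons.
Qed.

Lemma stepop_expose2 a G H s : stepop a expose (G :: H :: s) = expose (G :: H :: s).
Proof. by rewrite (lastI H s) stepop_expose -rcons_cons expose_rcons. Qed.

Lemma stepop_expose_le a s : 0 <= a -> stepop a expose s <= expose s.
Proof.
move=> a0; case: s => [|G [|H s]]; first by [].
  by rewrite [leRHS]/= kill_lim_nil// stepop_le1// => t; apply: expose_le1.
by rewrite stepop_expose2.
Qed.

(* Probability of reaching the root of [s] but never leaving [s] through it. *)
Definition gap s := if s is _ :: _ then expose s - kill_lim 1 s else 0.

(** Leaving [s] through its root requires that root to be exposed first. *)
Lemma gap_ge0 s : 0 <= gap s.
Proof.
case: s => [|G s] //; rewrite subr_ge0.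
(* [expose] is 0 at the empty stack; the comparison with killing needs the value 1 there. *)
pose psi t := if t is _ :: _ then expose t else 1.
rewrite -[expose _]/(psi (G :: s)).
apply: kill_lim_min => //; first by case=> // G' t; apply: expose_ge0.
case=> // F [|H t]; last by rewrite -[leRHS](stepop_expose2 1).
by rewrite [leRHS]/= kill_lim_nil// stepop_le1// => -[|? ?] //; apply: expose_le1.
Qed.

(* Bounds the expected flux when a root with boundary [F], below the stack [s], is
   next exposed. *)
Definition return_flux s F := kill_lim 1 s * flux F + gap s.
Definition stack_flux s := if s is G :: t then return_flux (belast G t) (last G t) else 0.

Lemma stack_flux_rcons s F : stack_flux (rcons s F) = return_flux s F.
Proof. by case: s => [|G s] //=; rewrite belast_rcons last_rcons. Qed.

Lemma return_flux_nil F : return_flux [::] F = flux F.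
Proof. by rewrite /return_flux kill_lim_nil// mul1r addr0. Qed.

Lemma stack_flux_ge0 s : 0 <= stack_flux s.
Proof.
case: s => [|G t] //=.
by rewrite addr_ge0 ?gap_ge0// mulr_ge0 ?kill_lim_ge0 ?flux_ge0.
Qed.

(** Above the root every case is an equality, so the loss comes only from steps taken at the
    root. *)
Lemma stepop_stack_flux a s : 0 <= a -> stepop a stack_flux s <= stack_flux s.
Proof.
move=> a0; case: s => [|G s]; first by [].
have [->|[t [F ->]]] : s = [::] \/ exists t F, s = rcons t F.
- by case: s => [|H s]; [left|right; exists (belast H s), (last H s); rewrite -lastI].
- rewrite stepop_root [stack_flux [::]]/= mulr0 add0r [leRHS]return_flux_nil.
  have := denom_ge0 G [::] a0; rewrite /= le_eqVlt => /orP[/eqP <-|D0].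
    by rewrite invr0 mulr0 flux_ge0.
  rewrite ler_pdivrMr//.
  apply: (@le_trans _ _ (\sum_(f <- G) flux G)).
    rewrite !big_seq ler_sum// => f fG.
    (* Crossing [f] replaces the value Q by (1 - q)(Q - q) + q with q = [esc f]. This is at most Q
       because Q - q, the flux of [rem f G], is nonnegative. *)
    rewrite /return_flux /= kill_lim_nil// (flux_rem fG).
    rewrite -[kill_lim 1 [:: ch f]](subKr 1) -/(esc f).
    have := esc_ge0 f; have := flux_ge0 (rem f G).
    have : esc f <= 1 by rewrite lerBlDr lerDl kill_lim_ge0.
    move: (esc f) (flux _) => *; nra.
  rewrite big_const_seq count_predT iter_addr_0 -[leLHS]mulr_natr ler_wpM2l ?flux_ge0//.
  by rewrite lerDl.
rewrite stepop_rcons -rcons_cons stack_flux_rcons.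
case: t => [|H t].
  rewrite /popr (@stack_flux_rcons [::]) return_flux_nil flux_cat.
  under eq_bigr do rewrite stack_flux_rcons /return_flux /= .
  rewrite /return_flux /= kill_lim_nil//.
  have D0 : (size G)%:R + 1 != 0 :> R by rewrite lt0r_neq0// ltr_wpDl.
  have -> : kill_lim 1 [:: G] = (1 + \sum_(g <- G) kill_lim 1 (push g G [::])) / ((size G)%:R + 1).
    by rewrite -kill_lim_fix// stepop1 kill_lim_nil.
  rewrite big_split/= -mulr_suml sumrB.
  rewrite (_ : \sum_(i <- G) kill_lim 1 [:: ch i] = (size G)%:R - flux G); last first.
    rewrite /flux sumrB big_const_seq count_predT iter_addr_0; ring.
  by rewrite le_eqVlt; apply/orP; left; apply/eqP; field.
have hg : (gap (pop G (H :: t)) + \sum_(g <- G) gap (push g G (H :: t))) / ((size G)%:R + 1)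
   = gap (G :: H :: t).
  rewrite /gap /= -[kill_lim 1 (G :: belast _ _)]/(expose (G :: H :: t)).
  rewrite -(stepop_expose2 1) -(@kill_lim_fix 1 (G :: _))// !stepop1 /=.
  by rewrite sumrB; ring.
have hk : (kill_lim 1 (pop G (H :: t)) + \sum_(g <- G) kill_lim 1 (push g G (H :: t))) / ((size G)%:R + 1)
   = kill_lim 1 (G :: H :: t).
  by rewrite -[RHS]kill_lim_fix// stepop1.
rewrite /popr stack_flux_rcons.
under eq_bigr do rewrite stack_flux_rcons.
rewrite /return_flux -hg -hk big_split/= -mulr_suml.
by rewrite le_eqVlt; apply/orP; left; apply/eqP; ring.
Qed.

(** When [s] is left, [F] is exposed and [kill_lim_root_ge] applies with the flux of that moment;
    the supermartingale [stack_flux] carries the bound back to the start. *)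
Lemma kill_lim1_le a s F : 2 <= a -> kill_lim 1 s <= kill_lim a (rcons s F) + 2 / a * return_flux s F.
Proof.
move=> a2; have a0 : 0 < a by lra.
have a0' := ltW a0.
have c0 : 0 <= 2 / a by rewrite divr_ge0.
have key n t L : kill 1 n t <= kill_lim a (rcons t L) + 2 / a * return_flux t L.
  elim: n t L => [|n IH] [|G t] L; rewrite ?kill_nil ?return_flux_nil ?kill_lim_root_ge//.
    rewrite /= -stack_flux_rcons addr_ge0 ?kill_lim_ge0// mulr_ge0// stack_flux_ge0//.
  rewrite -stack_flux_rcons.
  apply: (@le_trans _ _ (stepop a (fun t => kill_lim a t + 2 / a * stack_flux t) (G :: rcons t L))).
    rewrite /kill iterS -/(kill 1 n) stepop1 stepop_rcons.
    rewrite ler_wpM2r ?invr_ge0 ?addr_ge0// lerD//.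
      case: t => [|H t]; last by rewrite /popr stack_flux_rcons IH.
      by rewrite /popr (@stack_flux_rcons [::]); apply: IH.
    by rewrite ler_sum// => g _; rewrite stack_flux_rcons IH.
  rewrite stepopD stepopZ kill_lim_fix// lerD2l ler_wpM2l//.
  exact: stepop_stack_flux.
by apply: kill_lim_lim_le.
Qed.

(** * Infinitely many exposures of the root *)

Definition visit a i := iter i (stepop a) expose.

Lemma visit_ge0 a i s : 0 <= a -> 0 <= visit a i s.
Proof.
move=> a0; elim: i s => [|i IH] s; first exact: expose_ge0.
exact: stepop_ge0.
Qed.

Lemma visit_le1 a i s : 0 <= a -> visit a i s <= 1.
Proof.
move=> a0; elim: i s => [|i IH] s; first exact: expose_le1.
exact: stepop_le1.
Qed.

Lemma visit_nil a i : visit a i [::] = 0.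
Proof. by elim: i. Qed.

(** [visit a i] is the probability that the unkilled walk exposes the root at time [i] or later,
    which decreases in [i]. *)
Lemma visit_le a s : 0 <= a -> nonincreasing_seq (fun i => visit a i s).
Proof.
move=> a0; apply/nonincreasing_seqP => i.
elim: i s => [|i IH] s; first exact: stepop_expose_le.
exact: stepop_le.
Qed.

(* The probability of exposing the root infinitely often without being killed. *)
Definition recur a s : R := limn (fun i => visit a i s).

Lemma recur_cvg a s : 0 <= a -> visit a i s @[i --> \oo] --> recur a s.
Proof.
move=> a0; apply: nonincreasing_is_cvgn; first exact: visit_le.
by exists 0 => _ [n _ <-]; apply: visit_ge0.
Qed.

Lemma recur_visit a i s : 0 <= a -> recur a s <= visit a i s.
Proof.
move=> a0; apply: (@nonincreasing_cvgn_ge _ (fun n => visit a n s)); first exact: visit_le.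
by apply: cvgP; apply: recur_cvg.
Qed.

Lemma recur_fix a s : 0 <= a -> stepop a (recur a) s = recur a s.
Proof.
move=> a0; have h1 : stepop a (visit a n) s @[n --> \oo] --> stepop a (recur a) s.
  by apply: stepop_cvg => t; apply: recur_cvg.
have h2 : visit a n.+1 s @[n --> \oo] --> recur a s.
  by rewrite (cvg_shiftS (fun n => visit a n s)); apply: recur_cvg.
by apply: cvg_unique h1 h2.
Qed.

(** An exposure after time [i] is followed either by killing after time [i], whose probability tends
    to 0, or by survival, which [kill_lim1_le] bounds through the flux. *)
Lemma recur_le_stack_flux a s : 2 <= a -> recur a s <= 2 / a * stack_flux s.
Proof.
move=> a2; have a0 : 0 < a by lra.
have a0' := ltW a0.
have c0 : 0 <= 2 / a by rewrite divr_ge0.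
have h i t : visit a i t <= kill_lim a t + -1 * kill a i t + 2 / a * stack_flux t.
  elim: i t => [|i IH] t.
    case/lastP: t => [|t F]; first by rewrite /= kill_lim_nil//; lra.
    rewrite /= expose_rcons stack_flux_rcons (_ : (rcons t F == [::]) = false); last by case: t.
    by rewrite mulr0 addr0 kill_lim1_le.
  rewrite /visit iterS -/(visit a i); apply: (le_trans (stepop_le t a0' IH)).
  rewrite 2!stepopD !stepopZ kill_lim_fix// lerD2l ler_wpM2l//.
  exact: stepop_stack_flux.
have hc : kill_lim a s + -1 * kill a i s + 2 / a * stack_flux s @[i --> \oo] -->
    kill_lim a s + -1 * kill_lim a s + 2 / a * stack_flux s.
  apply: cvgD; last exact: cvg_cst.
  apply: cvgD; first exact: cvg_cst.
  by apply: cvgM; [exact: cvg_cst|exact: kill_lim_cvg].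
have := ler_cvg_to (@recur_cvg a s a0') hc.
rewrite mulN1r subrr add0r; apply.
by near=> i; apply: h.
Unshelve. all: by end_near. Qed.

(** The rate enters only at the root, where killing contributes 0 to [visit] and enlarges the
    denominator. *)
Lemma visit_anti a b i s : 0 <= a -> a <= b -> visit b i s <= visit a i s.
Proof.
move=> a0 ab; have b0 : 0 <= b by apply: le_trans ab.
elim: i s => [|i IH] s; first exact: lexx.
case: s => [|G [|H s]]; first by rewrite !visit_nil.
  rewrite /visit !iterS !stepop_root -!/(visit _ i) !visit_nil !mulr0 !add0r.
  have /= := denom_ge0 G [::] a0; rewrite le_eqVlt => /orP[/eqP D0|D0].
    have G0 : G = [::].
      case: G D0 => // g G /eqP; rewrite eq_sym gt_eqF//= ltr_wpDr//.
    by rewrite G0 !big_nil !mul0r.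
  have D1 : 0 < (size G)%:R + b by apply: lt_le_trans D0 _; rewrite lerD2l.
  apply: ler_pM.
  - by apply: sumr_ge0 => f _; apply: visit_ge0.
  - by rewrite invr_ge0 ltW.
  - by apply: ler_sum => f _; apply: IH.
  - by rewrite lef_pV2 ?posrE// lerD2l.
rewrite /visit !iterS -!/(visit _ i).
apply: (@le_trans _ _ (stepop b (visit a i) (G :: H :: s))); first exact: stepop_le.
by [].
Qed.

(** Convexity in the rate, multiplied out: [b] is the mean of the rates 0 and [k.+1 * b] with
    weights [k / k.+1] and [1 / k.+1]. *)
Lemma visit_convex b (k : nat) i s : 0 < b ->
  k.+1%:R * visit b i s <= k%:R * visit 0 i s + visit (k.+1%:R * b) i s.
Proof.
move=> b0; have b0' := ltW b0.
have kb0 : 0 <= k.+1%:R * b by rewrite mulr_ge0.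
elim: i s => [|i IH] s.
  by rewrite /visit /= -natr1 mulrDl mul1r.
case: s => [|G [|H s]].
- by rewrite !visit_nil !mulr0 addr0.
- rewrite /visit !iterS !stepop_root -!/(visit _ i) !visit_nil !mulr0 !add0r addr0.
  set x := \sum_(f <- G) visit 0 i _; set y := \sum_(f <- G) visit b i _.
  set z := \sum_(f <- G) visit _ i _.
  have hxyz : k.+1%:R * y <= k%:R * x + z.
    rewrite !mulr_sumr -big_split/=; apply: ler_sum => f _; exact: IH.
  have zx : z <= x by apply: ler_sum => f _; apply: visit_anti.
  have z0 : 0 <= z by apply: sumr_ge0 => f _; apply: visit_ge0.
  have x0 : 0 <= x by apply: le_trans zx.
  have [G0|] := eqVneq (size G) 0%N.
    have -> : x = 0 by rewrite /x (size0nil G0) big_nil.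
    have -> : y = 0 by rewrite /y (size0nil G0) big_nil.
    have -> : z = 0 by rewrite /z (size0nil G0) big_nil.
    by rewrite !mul0r !mulr0 addr0.
  rewrite -lt0n -(ltr0n R); move: (size G)%:R => d d0.
  have k0 : 0 <= k%:R :> R by [].
  move: hxyz kb0; rewrite -natr1; move: k0; move: (k%:R) => K K0 hxyz kb0.
  have db : 0 < d + b by lra.
  have dkb : 0 < d + (K + 1) * b by lra.
  apply: (@le_trans _ _ ((K * x + z) / (d + b))).
    by rewrite mulrA ler_wpM2r ?invr_ge0// ltW.
  (* Convexity of the inverse denominator leaves a product; it is nonnegative because the larger
     rate has the smaller sum, by [zx], and the larger denominator. *)
  rewrite -subr_ge0.
  have -> : K * (x / d) + z / (d + (K + 1) * b) - (K * x + z) / (d + b) =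
     K * b / (d + b) * (x / d - z / (d + (K + 1) * b)).
    by field; rewrite !lt0r_neq0.
  rewrite mulr_ge0// ?divr_ge0 ?mulr_ge0//; first by lra.
  rewrite subr_ge0; apply: ler_pM => //; first by rewrite invr_ge0 ltW.
  by rewrite lef_pV2 ?posrE//; lra.
rewrite /visit !iterS -!/(visit _ i).
(* Above the root [stepop] does not depend on the rate, so by conversion all rates become 0. *)
rewrite -[stepop (_ * b) _ _]/(stepop 0 (visit (k.+1%:R * b) i) (G :: H :: s)).
rewrite -[stepop b _ _]/(stepop 0 (visit b i) (G :: H :: s)).
by rewrite -!stepopZ -stepopD; apply: stepop_le.
Qed.

(** Convexity between the rates 0 and [k.+1 * a] gives [h1]. Running the walk [i] steps at rate [a]
    turns [expose] into [visit a i], whose limit is [recur a] itself; [k] of the [k.+1] copies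
    cancel, and [k] is arbitrarily large. *)
Lemma recur_pos a s : 0 < a -> recur a s = 0.
Proof.
move=> a0; have a0' := ltW a0.
have h (k : nat) : 2 <= k.+1%:R * a -> recur a s <= 2 / (k.+1%:R * a) * stack_flux s.
  move=> k2; have k20 : 0 <= k.+1%:R * a by lra.
  have h1 t : k.+1%:R * recur a t <= 2 / (k.+1%:R * a) * stack_flux t + k%:R * expose t.
    have hc : k%:R * visit 0 i t + visit (k.+1%:R * a) i t @[i --> \oo] -->
      k%:R * recur 0 t + recur (k.+1%:R * a) t.
      by apply: cvgD; [apply: cvgM; [exact: cvg_cst|]|]; apply: recur_cvg.
    have hd : k.+1%:R * visit a i t @[i --> \oo] --> k.+1%:R * recur a t.
      by apply: cvgM; [exact: cvg_cst|apply: recur_cvg].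
    have hm : k.+1%:R * recur a t <= k%:R * recur 0 t + recur (k.+1%:R * a) t.
      apply: ler_cvg_to hd hc _; near=> i; exact: visit_convex.
    apply: (le_trans hm); rewrite addrC lerD ?recur_le_stack_flux// ler_wpM2l//.
    exact: (recur_visit 0 t (lexx 0)).
  have h2 i t : k.+1%:R * recur a t <= 2 / (k.+1%:R * a) * stack_flux t + k%:R * visit a i t.
    elim: i t => [|i IH] t; first exact: h1.
    rewrite -recur_fix// -stepopZ; apply: (le_trans (stepop_le t a0' IH)).
    rewrite stepopD !stepopZ lerD2r ler_wpM2l ?stepop_stack_flux// divr_ge0//.
  have hc : 2 / (k.+1%:R * a) * stack_flux s + k%:R * visit a i s @[i --> \oo] -->
     2 / (k.+1%:R * a) * stack_flux s + k%:R * recur a s.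
    apply: cvgD; [exact: cvg_cst|apply: cvgM; [exact: cvg_cst|exact: recur_cvg]].
  have : k.+1%:R * recur a s <= 2 / (k.+1%:R * a) * stack_flux s + k%:R * recur a s.
    apply: ler_cvg_to (cvg_cst _) hc _; near=> i; exact: h2.
  by rewrite -{1}natr1 mulrDl mul1r addrC lerD2r.
apply/eqP; rewrite eq_le; apply/andP; split; last first.
  apply: limr_ge; first by apply: cvgP; apply: recur_cvg.
  by near=> n; apply: visit_ge0.
apply/ler_addgt0Pl => e e0; rewrite addr0.
(* The first summand makes the rate [k.+1 * a] at least 2, the second brings the flux bound below
   [e]. *)
have [k hk] : exists k : nat, 2 / a + 2 * stack_flux s / (a * e) <= k.+1%:R.
  exists (Num.truncn (2 / a + 2 * stack_flux s / (a * e))).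
  by rewrite ltW// truncnS_gt.
have p0 := stack_flux_ge0 s.
have q0 : 0 <= 2 / a by rewrite divr_ge0.
have q1 : 0 <= 2 * stack_flux s / (a * e) by rewrite divr_ge0// mulr_ge0// ltW.
have k2 : 2 <= k.+1%:R * a by rewrite -ler_pdivrMr//; lra.
apply: (le_trans (h k k2)).
rewrite mulrAC ler_pdivrMr; last by lra.
have : 2 * stack_flux s / (a * e) <= k.+1%:R by lra.
by rewrite ler_pdivrMr ?mulr_gt0// mulrA [leRHS]mulrC.
Unshelve. all: by end_near. Qed.

(** The walks of rates 0 and [a] agree until the killing. *)
Lemma visit0_le a i s : 0 < a -> visit 0 i s <= kill_lim a s + visit a i s.
Proof.
move=> a0; have a0' := ltW a0.
elim: i s => [|i IH] s; first by rewrite lerDr kill_lim_ge0.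
rewrite -kill_lim_fix// /visit !iterS -!/(visit _ i).
case: s => [|G [|H s]].
- by rewrite /= kill_lim_nil// !visit_nil addr0.
- rewrite !stepop_root kill_lim_nil// !visit_nil !mulr0 !add0r mulr1 -mulrDl.
  have h : \sum_(f <- G) visit 0 i [:: ch f; rem f G] <= (size G)%:R.
    by rewrite -sum1_size natr_sum; apply: ler_sum => f _; apply: visit_le1.
  have h0 : 0 <= \sum_(f <- G) visit 0 i [:: ch f; rem f G].
    by apply: sumr_ge0 => f _; apply: visit_ge0.
  have h1 : \sum_(f <- G) visit 0 i [:: ch f; rem f G] <=
     \sum_(f <- G) kill_lim a [:: ch f; rem f G] + \sum_(f <- G) visit a i [:: ch f; rem f G].
    by rewrite -big_split/=; apply: ler_sum => f _; apply: IH.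
  move: h h0 h1; move: (\sum_(f <- G) _) => x; move: (\sum_(f <- G) _) => y.
  move: (\sum_(f <- G) _) => z xG x0 xyz.
  have d0 : 0 <= (size G)%:R :> R by [].
  rewrite addr0 ler_pdivlMr; last by lra.
  have [G0|] := eqVneq (size G)%:R (0 : R); first by rewrite G0 invr0 mulr0 mul0r; lra.
  rewrite neq_lt ltNge d0/= => d1.
  rewrite mulrDr divfK ?lt0r_neq0//.
  (* A visit has probability at most 1, so the killing term [a] pays for the smaller denominator at
     rate 0. *)
  have : x / (size G)%:R * a <= a by rewrite -[leRHS]mul1r ler_wpM2r// ler_pdivrMr// mul1r.
  lra.
rewrite -[stepop a (visit a i) _]/(stepop 0 (visit a i) (G :: H :: s)).
rewrite -[stepop a (kill_lim a) _]/(stepop 0 (kill_lim a) (G :: H :: s)).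
by rewrite -stepopD; apply: stepop_le.
Qed.

(** * Conductances, and the root at rate 0 *)

Section Conductance.
Variable c : E -> R.
Definition cond F := \sum_(f <- F) c f.

(** The second condition is [c f <= C / (1 + C)] with C the total weight behind [f]. Equality is the
    series law for a unit edge followed by the branches behind it, which effective conductances to
    infinity satisfy. *)
Definition subsolution := forall f, 0 <= c f /\ c f * (1 + cond (ch f)) <= cond (ch f).

Hypothesis csub : subsolution.

Lemma cond_ge0 F : 0 <= cond F.
Proof. by apply: sumr_ge0 => f _; case: (csub f). Qed.

(* Hitting probability of the killing state for simple random walk on the current
   contracted network, [x] being the effective conductance seen from the top class. *)
Fixpoint hitpot a (x : R) s : R :=
  if s is F :: t then (1 + x)^-1 * hitpot a (cond F + x / (1 + x)) t else a / (a + x).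

Lemma hitpot_ge0 a x s : 0 < a -> 0 <= x -> 0 <= hitpot a x s.
Proof.
move=> a0; elim: s x => [|F s IH] x x0 /=; first by rewrite divr_ge0 ?addr_ge0// ltW.
rewrite mulr_ge0 ?invr_ge0 ?addr_ge0//; apply: IH.
by rewrite addr_ge0 ?cond_ge0// divr_ge0// addr_ge0.
Qed.

Lemma div1D_le (x y : R) : 0 <= x -> x <= y -> x / (1 + x) <= y / (1 + y).
Proof.
move=> x0 xy; rewrite ler_pdivrMr; last by lra.
rewrite mulrAC ler_pdivlMr; last by lra.
by nra.
Qed.

Lemma hitpot_anti a x y s : 0 < a -> 0 <= x -> x <= y -> hitpot a y s <= hitpot a x s.
Proof.
move=> a0; elim: s x y => [|F s IH] x y x0 xy /=.
  rewrite ler_wpM2l ?(ltW a0)// lef_pV2 ?posrE//; lra.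
have y0 : 0 <= y by apply: le_trans xy.
apply: ler_pM.
- by rewrite invr_ge0 addr_ge0.
- by apply: hitpot_ge0 => //; rewrite addr_ge0 ?cond_ge0// divr_ge0// addr_ge0.
- by rewrite lef_pV2 ?posrE//; lra.
- apply: IH; first by rewrite addr_ge0 ?cond_ge0// divr_ge0// addr_ge0.
  by rewrite lerD2l div1D_le.
Qed.

Definition hitstack a s := if s is F :: t then hitpot a (cond F) t else 1.

(** With C = [cond (ch f)], moving behind [f] costs the factor [1 / (1 + C) <= 1 - c f], and the way
    back sees the branch [f] with conductance [C / (1 + C) >= c f]. *)
Lemma hitstack_push a G f t : 0 < a -> f \in G ->
  hitstack a (push f G t) <= (1 - c f) * hitpot a (cond G) t.
Proof.
move=> a0 fG; have [cf0 cf] := csub f.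
have C0 := cond_ge0 (ch f).
rewrite /push /=; apply: ler_pM.
- by rewrite invr_ge0 addr_ge0.
- by apply: hitpot_ge0 => //; rewrite addr_ge0 ?cond_ge0// divr_ge0// addr_ge0.
- by rewrite -div1r ler_pdivrMr; lra.
- apply: hitpot_anti => //; first exact: cond_ge0.
  have -> : cond G = cond (rem f G) + c f.
    by rewrite /cond (perm_big _ (perm_to_rem fG)) big_cons addrC.
  by rewrite lerD2l ler_pdivlMr; lra.
Qed.

(** With d the size of [G], w the weight of the way back and X the present value, the pushes
    contribute at most (d - cond G) X and the pop at most (w + cond G) X. Contraction helps in the
    pop: merging adds all of x = [cond G] to the class below, not only [x / (1 + x)]. *)
Lemma stepop_hitstack a s : 0 < a -> stepop a (hitstack a) s <= hitstack a s.
Proof.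
move=> a0; case: s => [|G t] //; rewrite [hitstack a (G :: t)]/=.
have C0 := cond_ge0 G.
set X := hitpot a (cond G) t.
have X0 : 0 <= X by apply: hitpot_ge0.
have w0 : 0 < wt a t by case: (t).
have d0 : 0 < (size G)%:R + wt a t by rewrite ltr_wpDl.
have hp : wt a t * hitstack a (pop G t) <= (wt a t + cond G) * X.
  rewrite /X; case: (t) => [|H u] /=.
    by rewrite mulr1 mulrCA divff ?mulr1// lt0r_neq0//; lra.
  rewrite mul1r mulrA divff ?mul1r ?lt0r_neq0//; last by lra.
  apply: hitpot_anti => //; first by rewrite addr_ge0 ?cond_ge0// divr_ge0// addr_ge0.
  have -> : cond (G ++ H) = cond H + cond G by rewrite /cond big_cat addrC.
  rewrite lerD2l ler_pdivrMr; last by lra.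
  by rewrite mulrDr mulr1 lerDl mulr_ge0.
rewrite ler_pdivrMr//.
have hs : \sum_(f <- G) hitstack a (push f G t) <= ((size G)%:R - cond G) * X.
  apply: (@le_trans _ _ (\sum_(f <- G) (1 - c f) * X)).
    by rewrite !big_seq ler_sum// => f fG; apply: hitstack_push.
  by rewrite -mulr_suml sumrB -sum1_size natr_sum.
by apply: le_trans (lerD hp hs) _; lra.
Qed.

Lemma kill_lim_le_cond a F : 0 < a -> kill_lim a [:: F] <= a / (a + cond F).
Proof.
move=> a0; rewrite -[leRHS]/(hitstack a [:: F]).
apply: kill_lim_min; [exact: ltW|by []| |by move=> t; apply: stepop_hitstack].
by case=> [|G t] //=; apply: hitpot_ge0 => //; apply: cond_ge0.
Qed.

Lemma recur0_root F : 0 < cond F -> recur 0 [:: F] = 0.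
Proof.
move=> F0; apply/eqP; rewrite eq_le; apply/andP; split; last first.
  apply: limr_ge; first by apply: cvgP; apply: recur_cvg.
  by near=> n; apply: visit_ge0.
apply/ler_addgt0Pl => e e0; rewrite addr0.
(* This rate makes the bound [a / (a + cond F)] at most [e]. *)
pose a := e * cond F.
have a0 : 0 < a by rewrite mulr_gt0.
have hc : kill_lim a [:: F] + visit a i [:: F] @[i --> \oo] --> kill_lim a [:: F] + recur a [:: F].
  by apply: cvgD; [exact: cvg_cst|apply: recur_cvg; rewrite ltW].
have : recur 0 [:: F] <= kill_lim a [:: F] + recur a [:: F].
  apply: ler_cvg_to (@recur_cvg 0 [:: F] (lexx 0)) hc _; near=> i; exact: visit0_le.
rewrite (@recur_pos a)// addr0 => /le_trans; apply.
apply: (le_trans (kill_lim_le_cond F a0)).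
rewrite ler_pdivrMr; last by lra.
by rewrite mulrDr -/a lerDr mulr_ge0// ltW.
Unshelve. all: by end_near. Qed.

End Conductance.

Lemma visit_small a s e : 0 <= a -> recur a s = 0 -> 0 < e -> exists i, visit a i s <= e.
Proof.
move=> a0 r0 e0; have := @recur_cvg a s a0; rewrite r0 => /cvgrPdist_lt /(_ e e0).
case=> n _ /(_ n (leqnn n)) /=; rewrite sub0r normrN ger0_norm ?visit_ge0// => /ltW.
by exists n.
Qed.

End Stack.

(** * Loop contracting random walk on a tree *)

Section LcrwStack.
Variables (V : countType) (nb : V -> seq V).

(* Every edge separates its endpoints: acyclicity in the form that passes to subdivisions. *)
Definition has_cuts := forall a b, b \in nb a ->
  exists s : V -> bool, s a != s b /\
    forall c d, d \in nb c -> (c, d) <> (a, b) -> (c, d) <> (b, a) -> s c = s d.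

Hypothesis nb_uniq : forall x, uniq (nb x).
Hypothesis nb_irr : forall x, x \notin nb x.
Hypothesis nb_sym : forall x y, y \in nb x -> x \in nb y.
Hypothesis cuts : has_cuts.

Definition flip (e : V * V) := (e.2, e.1).
(** The instance of [ch] for the tree: the reverse of [e] is left out, being the edge leading
    back. *)
Definition onward (e : V * V) := [seq (e.2, w) | w <- nb e.2 & w != e.1].
Definition star (x : V) := [seq (x, w) | w <- nb x].

Lemma mem_onward e f : (f \in onward e) = [&& f.1 == e.2, f.2 \in nb e.2 & f.2 != e.1].
Proof.
case: f => a b; apply/mapP/and3P => [[w]|[/= /eqP -> h1 h2]].
  by rewrite mem_filter => /andP[h1 h2] [-> ->].
by exists b => //; rewrite mem_filter h2.
Qed.

Lemma onward_uniq e : uniq (onward e).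
Proof. by rewrite map_inj_uniq ?filter_uniq// => x y []. Qed.

Lemma mem_out X e : (e \in out_edges nb X) = [&& e.1 \in X, e.2 \in nb e.1 & e.2 \notin X].
Proof.
case: e => a b; apply/allpairsPdep/and3P => [[u [w [uX]]]|[/= h1 h2 h3]].
  by rewrite mem_filter => /andP[h1 h2] [-> ->].
by exists a, b; rewrite mem_filter h3 h2.
Qed.

Lemma out_uniq X : uniq X -> uniq (out_edges nb X).
Proof.
move=> uX; apply: allpairs_uniq_dep => //; first by move=> x _; rewrite filter_uniq.
by move=> [a b] [c d] _ _ /= [-> ->].
Qed.

Lemma out1 f : f.2 \in nb f.1 -> perm_eq (out_edges nb [:: f.2]) (flip f :: onward f).
Proof.
move=> fnb; apply: uniq_perm; first by rewrite out_uniq.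
  by rewrite /= onward_uniq mem_onward/= !eqxx andbF.
case=> a b; rewrite mem_out !inE mem_onward/= /flip xpair_eqE.
have [->|] //= := eqVneq a f.2.
have [->|bf] /= := eqVneq b f.1.
  by rewrite nb_sym//=; apply: contraL fnb => /eqP <-.
rewrite andbT; have [->|_] := eqVneq b f.2; last by rewrite andbT.
by rewrite (negbTE (nb_irr _)).
Qed.

(** Connectedness of the subgraph induced on [U], phrased with two-colourings so that it meets
    [has_cuts] directly. *)
Definition lconn (U : seq V) := forall s : V -> bool,
  (forall c d, c \in U -> d \in U -> d \in nb c -> s c = s d) ->
  forall c d, c \in U -> d \in U -> s c = s d.

(** Two edges from [w] into a connected set would join the two sides of the cut of [(u, w)] without
    using that edge. *)
Lemma lconn_out U u u' w : lconn U -> u \in U -> u' \in U -> w \notin U ->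
  w \in nb u -> w \in nb u' -> u' = u.
Proof.
move=> cU uU u'U wU wu wu'; have [s [suw sc]] := cuts wu.
have ss : s u = s u'.
  apply: cU => // c d cU' dU dc; apply: sc => // -[ec ed].
    by rewrite -ed dU in wU.
  by rewrite -ec cU' in wU.
apply: contraNeq suw => uu'; rewrite ss; apply/eqP/sc => //; case.
  by move=> uE; rewrite uE eqxx in uu'.
by move=> uE; move: wU; rewrite -uE u'U.
Qed.

(* [l] is the current path, last edge first; [ex] are out-edges of its last class
   that are not listed on top of [S]. *)
Fixpoint matches (X0 : seq V) (l : seq ((V * V) * seq V)) (ex : seq (V * V))
    (S : seq (seq (V * V))) : Prop :=
  match l, S with
  | [::], [:: F] => perm_eq (out_edges nb X0) (ex ++ F)
  | (e, X) :: l', F :: S' => perm_eq (out_edges nb X) (ex ++ flip e :: F) /\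
                             matches X0 l' [:: e] S'
  | _, _ => False
  end.

Definition visited (st : lstate V) := flatten (path_classes st).

(** The invariant of the walk: every edge on the stack leads from a visited to an unvisited vertex,
    so crossing it extends the path and closes no cycle. *)
Definition lrep (st : lstate V) S :=
  [/\ uniq (visited st), lconn (visited st), matches st.1 (rev st.2) [::] S,
      uniq (flatten S) &
      forall f, f \in flatten S ->
        [/\ f.1 \in visited st, f.2 \notin visited st & f.2 \in nb f.1]].

Lemma lrep_start x : lrep (lstart x) [:: star x].
Proof.
split; rewrite ?/visited ?/path_classes /= ?cats0 //.
- by move=> s _ c d; rewrite !inE => /eqP -> /eqP ->.
- apply: uniq_perm; first by rewrite out_uniq.
    by rewrite map_inj_uniq// => a b [].
  case=> a b; rewrite mem_out !inE/=; apply/and3P/mapP => [[/eqP -> h _]|[w wx [-> ->]]].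
    by exists b.
  by rewrite eqxx wx; split=> //; apply: contraL wx => /eqP ->.
- by rewrite map_inj_uniq// => a b [].
- move=> f /mapP[w wx ->] /=; rewrite !inE eqxx; split=> //.
  by apply: contraL wx => /eqP ->.
Qed.

Lemma matches_size X0 l ex S : matches X0 l ex S -> size S = (size l).+1.
Proof.
elim: l ex S => [|[e X] l IH] ex [|F S] //=; first by case: S.
by case=> _ /IH ->.
Qed.

Lemma matches_push X0 l F S f : f \in F -> matches X0 l [::] (F :: S) ->
  matches X0 l [:: f] (rem f F :: S).
Proof.
move=> fF; case: l => [|[e X] l] /=.
  by case: S => // /perm_trans -> //; rewrite perm_to_rem.
case=> h ?; split=> //; apply: (perm_trans h).
rewrite -[_ :: _ :: _]/([:: f] ++ [:: flip e] ++ rem f F) perm_sym perm_catCA /= perm_cons.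
by rewrite perm_sym perm_to_rem.
Qed.

Lemma matches_extra X0 l ex S e : matches X0 l ex S -> e \in ex ->
  e.1 \in flatten (X0 :: map snd l).
Proof.
case: l => [|[e' X] l] /=.
  case: S => // F [|//] h ee.
  have : e \in out_edges nb X0 by rewrite (perm_mem h) mem_cat ee.
  by rewrite mem_out mem_cat => /andP[->].
case: S => // F S [h _] ee.
have : e \in out_edges nb X by rewrite (perm_mem h) mem_cat ee.
by rewrite mem_out !mem_cat => /andP[->]; rewrite orbT.
Qed.

Lemma mem_flatten_rev (T : eqType) (s : seq (seq T)) x : (x \in flatten (rev s)) = (x \in flatten s).
Proof. by apply/flattenP/flattenP => -[y]; rewrite ?mem_rev => h1 h2; exists y; rewrite ?mem_rev. Qed.

Definition back (st : lstate V) :=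
  if rev st.2 is (e, _) :: _ then [:: flip e] else [::].

Lemma lrep_out st F S : lrep st (F :: S) ->
  perm_eq (out_edges nb (cur st)) (back st ++ F).
Proof.
case: st => X0 p [_ _ + _ _]; rewrite /back /cur /=.
case/lastP: p => [|p [e X]]; rewrite ?rev_rcons /=; first by case: S.
by rewrite map_rcons last_rcons => -[].
Qed.

Lemma visited_rcons X0 p x : visited (X0, rcons p x) = visited (X0, p) ++ x.2.
Proof. by rewrite /visited /path_classes /= map_rcons flatten_rcons catA. Qed.

Lemma lrep_push st F S f : lrep st (F :: S) -> f \in F ->
  lstep nb st f = (st.1, rcons st.2 (f, [:: f.2])) /\
  lrep (lstep nb st f) (push onward f F S).
Proof.
move=> rp fF; have := lrep_out rp; case: rp => uU cU mt uS hS ot.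
have fS : f \in flatten (F :: S) by rewrite mem_cat fF.
have [f1 f2 fnb] := hS f fS.
have fo : f \in out_edges nb (cur st) by rewrite (perm_mem ot) mem_cat fF orbT.
have -> : lstep nb st f = (st.1, rcons st.2 (f, [:: f.2])).
  rewrite /lstep fo hasNfind ?ltnn//; apply/hasPn => X Xc.
  by apply: contra f2 => h; apply/flattenP; exists X.
split=> //; case: st uU cU mt hS f1 f2 {ot fo} => X0 p uU cU mt hS f1 f2.
have vE : visited (X0, rcons p (f, [:: f.2])) = visited (X0, p) ++ [:: f.2].
  exact: visited_rcons.
split; rewrite ?vE.
- by rewrite cats1 rcons_uniq f2.
- move=> s h.
  have hU c d : c \in visited (X0, p) -> d \in visited (X0, p) -> s c = s d.
    by apply: cU => a b aU bU; apply: h; rewrite mem_cat ?aU ?bU.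
  have hf : s f.1 = s f.2 by apply: h => //; rewrite (mem_cat _ (visited _)) ?f1// inE eqxx orbT.
  move=> c d; rewrite !(mem_cat _ (visited _)) !inE => /orP[cU'|/eqP ->] /orP[dU|/eqP ->] //.
  + exact: hU.
  + by rewrite -hf; apply: hU.
  + by rewrite -hf; apply: hU.
- rewrite /= rev_rcons /= out1//; split=> //; exact: matches_push.
- rewrite /push /= !cat_uniq onward_uniq /=.
  move: uS; rewrite /= cat_uniq => /and3P[uF hFS uS].
  rewrite rem_uniq//= uS andbT; apply/andP; split; last first.
    by apply: contra hFS => /hasP[x h1 h2]; apply/hasP; exists x => //; apply: mem_rem h2.
  apply/hasPn => x xS; rewrite mem_onward; apply/and3P => -[/eqP h _ _].
  have : x \in flatten (F :: S).
    by move: xS; rewrite !mem_cat => /orP[/mem_rem ->|->]; rewrite ?orbT.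
  by move=> /hS[h1 _ _]; rewrite h (negbTE f2) in h1.
- move=> g; rewrite /push /= mem_cat !(mem_cat _ (visited _)) !inE => /orP[|gS].
    rewrite mem_onward => /and3P[/eqP g1 g2 g3]; rewrite g1 eqxx orbT; split=> //.
    rewrite negb_or; apply/andP; split; last first.
      by apply: contraL g2 => /eqP ->.
    (* A visited neighbour of [f.2] can only be [f.1]. *)
    apply: contra g3 => gU; apply/eqP.
    by apply: (lconn_out cU f1 gU f2) => //; apply: nb_sym.
  have gFS : g \in flatten (F :: S).
    by move: gS; rewrite !mem_cat => /orP[/mem_rem ->|->]; rewrite ?orbT.
  have [g1 g2 g3] := hS g gFS; rewrite g1 negb_or g2; split=> //=.
  (* A stack edge with the same head as [f] is [f] itself, which has just been removed. *)
  apply: contraTN gS => /eqP gf.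
  have gE : g = f.
    rewrite gf in g3; rewrite [g]surjective_pairing [f]surjective_pairing gf.
    by rewrite (lconn_out cU f1 g1 f2 fnb g3).
  move: uS; rewrite /= cat_uniq => /and3P[uF hFS uS].
  rewrite gE mem_cat negb_or mem_rem_uniqF//=.
  by apply: contra hFS => h; apply/hasP; exists f.
Qed.

(** [Y] is the class below, [X] the top class, [e] the edge from [Y] to [X] and [B] the way back
    from [Y]. Merging loses [e] and its reverse and nothing else. *)
Lemma out_merge X Y e B F G : uniq (Y ++ X) ->
  perm_eq (out_edges nb Y) (e :: B ++ G) -> perm_eq (out_edges nb X) (flip e :: F) ->
  (forall f, f \in B ++ F ++ G -> f.2 \notin Y ++ X) ->
  perm_eq (out_edges nb (Y ++ X)) (B ++ F ++ G).
Proof.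
move=> uYX pY pX hd.
have [uY hYX uX] : [/\ uniq Y, ~~ has (in_mem^~ (mem Y)) X & uniq X].
  by move: uYX; rewrite cat_uniq => /and3P.
have uoY : uniq (e :: B ++ G) by rewrite -(perm_uniq pY) out_uniq.
have uoX : uniq (flip e :: F) by rewrite -(perm_uniq pX) out_uniq.
have mY f : f \in e :: B ++ G -> f.1 \in Y.
  by rewrite -(perm_mem pY) mem_out => /andP[].
have mX f : f \in flip e :: F -> f.1 \in X.
  by rewrite -(perm_mem pX) mem_out => /andP[].
have disj (f : V * V) : f.1 \in Y -> f.1 \in X -> False.
  by move=> h1 h2; move/hasPn: hYX => /(_ _ h2); rewrite h1.
have e1 : e.1 \in Y by apply: mY; rewrite inE eqxx.
have e2 : e.2 \in X by apply: (mX (flip e)); rewrite inE eqxx.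
apply: uniq_perm; first by rewrite out_uniq.
  rewrite uniq_catCA cat_uniq; move: uoX uoY => /= /andP[_ ->] /andP[_ ->].
  rewrite andbT /=; apply/hasPn => f fBG; apply/negP => fF.
  by apply: (disj f); [apply: mY; rewrite inE fBG orbT|apply: mX; rewrite inE fF orbT].
move=> f; apply/idP/idP => [|fB].
  rewrite mem_out !mem_cat negb_or => /and3P[/orP[f1|f1] f2 /andP[f3 f4]].
    have : f \in out_edges nb Y by rewrite mem_out f1 f2.
    rewrite (perm_mem pY) inE mem_cat => /orP[/eqP fe|/orP[->//|->]]; last by rewrite !orbT.
    by rewrite fe e2 in f4.
  have : f \in out_edges nb X by rewrite mem_out f1 f2.
  rewrite (perm_mem pX) inE => /orP[/eqP fe|->]; last by rewrite orbT.
  by rewrite fe e1 in f3.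
rewrite mem_out hd// andbT mem_cat.
move: fB; rewrite !mem_cat => /or3P[] h.
- have : f \in out_edges nb Y by rewrite (perm_mem pY) inE mem_cat h orbT.
  by rewrite mem_out => /and3P[-> ->].
- have : f \in out_edges nb X by rewrite (perm_mem pX) inE h orbT.
  by rewrite mem_out orbC => /and3P[-> ->].
- have : f \in out_edges nb Y by rewrite (perm_mem pY) inE mem_cat h !orbT.
  by rewrite mem_out => /and3P[-> ->].
Qed.

Lemma find_class (A : seq (seq V)) Y X v : uniq (flatten (A ++ [:: Y; X])) -> v \in Y ->
  find (fun c => v \in c) (A ++ [:: Y; X]) = size A.
Proof.
move=> u vY; rewrite find_cat; case: ifP => [/hasP[Z ZA vZ]|_]; last by rewrite /= vY addn0.
move: u; rewrite flatten_cat cat_uniq => /and3P[_ /hasPn /(_ v) + _].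
rewrite /= !mem_cat vY => /(_ isT) /flattenP[]; by exists Z.
Qed.

(** The edge leading back closes a cycle of length two, so [lstep] merges the last two classes. *)
Lemma lrep_pop X0 p e X F S : lrep (X0, rcons p (e, X)) (F :: S) ->
  size (lstep nb (X0, rcons p (e, X)) (flip e)).2 = size p /\
  lrep (lstep nb (X0, rcons p (e, X)) (flip e)) (pop F S).
Proof.
move=> rp; have := lrep_out rp; case: rp => uU cU mt uS hS.
rewrite /back /= rev_rcons /cur /= map_rcons last_rcons => ot.
have fo : flip e \in out_edges nb X by rewrite (perm_mem ot) inE eqxx.
move: mt; rewrite /= rev_rcons => -[pX mt].
case: S mt uS hS => [|G S]; first by case: (rev p) => [|[]].
move=> mt uS hS.
set U := visited _ in uU cU hS *.
have hd f : f \in F ++ G -> f.2 \notin U.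
  by rewrite mem_cat => fFG; case: (hS f) => //; rewrite !mem_cat orbA fFG.
have [e1 e2] : e.1 \notin X /\ e.2 \in X.
  by move: fo; rewrite mem_out /= => /and3P[].
suff [Y' [p' [E1 E2 E3 E4]]] : exists Y' p',
    [/\ lstep nb (X0, rcons p (e, X)) (flip e) = (Y', p'), size p' = size p,
    visited (Y', p') = U & matches Y' (rev p') [::] ((F ++ G) :: S)].
  rewrite E1; split=> //; split; rewrite ?E3 //.
    by rewrite /= -catA.
  by move=> f; rewrite /= -catA => /hS.
(* A path of one edge contracts into the starting class, the branch [j == 0] of [lstep]; otherwise
   the merged class keeps the incoming edge [e'] of [Y]. *)
case/lastP: p => [|p [e' Y]] in ot U uU cU hS hd mt *.
  exists (X0 ++ X), [::]; case: S mt uS hS => // pY _ _.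
  have UE : U = X0 ++ X by rewrite /U /visited /= cats0.
  have eY : e.1 \in X0.
    have : e \in out_edges nb X0 by rewrite (perm_mem pY) inE eqxx.
    by rewrite mem_out => /andP[].
  split=> //; last 1 first.
  - apply: (@out_merge _ _ e [::] F G); rewrite -?UE //.
  - rewrite /lstep /cur /= fo eY /= cats0 //.
  - by rewrite /visited /= cats0.
exists X0, (rcons p (e', Y ++ X)).
have UE : U = flatten ((X0 :: map snd p) ++ [:: Y; X]).
  by rewrite /U /visited /path_classes /= -cats1 map_cat -cats1 map_cat /= -catA.
move: mt; rewrite rev_rcons /= => -[pY mt].
have [eY eYX] : e \in out_edges nb Y /\ flip e' \in out_edges nb Y.
  by rewrite !(perm_mem pY) !inE !eqxx orbT.
have eY1 : e.1 \in Y by move: eY; rewrite mem_out => /andP[].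
have uU' := uU; rewrite UE in uU'.
have fE := find_class uU' eY1.
split.
- rewrite /lstep.
  have -> : cur (X0, rcons (rcons p (e', Y)) (e, X)) = X by rewrite /cur /= map_rcons last_rcons.
  have -> : path_classes (X0, rcons (rcons p (e', Y)) (e, X)) = (X0 :: map snd p) ++ [:: Y; X].
    by rewrite /path_classes /= !map_rcons -!cats1 -catA.
  rewrite fo fE size_cat [size [:: Y; X]]/= addnS ltnS leq_addr.
  rewrite drop_size_cat//= size_map cats0 -!cats1 -catA.
  by rewrite take_size_cat// nth_cat ltnn subnn.
- by rewrite !size_rcons.
- rewrite UE /visited /path_classes /= map_rcons flatten_rcons flatten_cat /=.
  by rewrite !cats0.
- rewrite rev_rcons /=; split=> //.
  have uYX : uniq (Y ++ X).
    by move: uU'; rewrite flatten_cat cat_uniq /= cats0 => /and3P[].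
  apply: (@out_merge _ _ e [:: flip e'] F G) => // f.
  have sub : {subset Y ++ X <= U}.
    by move=> v vYX; rewrite UE flatten_cat mem_cat /= cats0 vYX orbT.
  rewrite inE => /orP[/eqP ->|fFG]; last by apply: contra (hd f fFG); apply: sub.
  (* The head of [flip e'] lies in a class further down, disjoint from [Y] and [X]. *)
  have he := matches_extra mt (mem_head _ _).
  move: uU'; rewrite flatten_cat cat_uniq /= cats0 => /and3P[_ /hasPn h _].
  apply/negP => /h; rewrite /= -/flatten.
  move: he; rewrite /= mem_cat map_rev mem_flatten_rev => he.
  by rewrite mem_cat he.
Qed.

Local Open Scope ring_scope.

(** * Finite-horizon probabilities of the walk, bounded by stacks *)

Section Functionals.
Variable K : numFieldType.

Definition out_avg (g : lstate V -> K) (st : lstate V) : K :=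
  (\sum_(e <- out_edges nb (cur st)) g (lstep nb st e)) / (size (out_edges nb (cur st)))%:R.

(* [reach]: the path has length at most [j] within [m] steps; [dwell]: the length is
   at least [j] for [i] steps, and then [reach] holds. *)
Fixpoint reach (j m : nat) (st : lstate V) : K :=
  if (size st.2 <= j)%N then 1 else if m is m'.+1 then out_avg (reach j m') st else 0.

Fixpoint dwell (j i m : nat) (st : lstate V) : K :=
  if (size st.2 < j)%N then 0 else
  if i is i'.+1 then out_avg (dwell j i' m) st else reach j m st.

Lemma out_avg_ge0 g st : (forall st', 0 <= g st') -> 0 <= out_avg g st.
Proof. by move=> g0; rewrite divr_ge0// sumr_ge0. Qed.

Lemma reach_ge0 j m st : 0 <= reach j m st.
Proof. by elim: m st => [|m IH] st /=; case: ifP => // _; apply: out_avg_ge0. Qed.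

Lemma dwell_ge0 j i m st : 0 <= dwell j i m st.
Proof.
elim: i st => [|i IH] st /=; case: ifP => // _; first exact: reach_ge0.
exact: out_avg_ge0.
Qed.

End Functionals.

Lemma dwell_ratr (K : numFieldType) j i m st : dwell K j i m st = ratr (dwell rat j i m st).
Proof.
have hA (g : lstate V -> K) g' st' : (forall s, g s = ratr (g' s)) ->
    out_avg g st' = ratr (out_avg g' st').
  move=> h; rewrite /out_avg fmorph_div/= rmorph_nat rmorph_sum/=; congr (_ / _).
  by apply: eq_bigr.
have hR j' m' st' : reach K j' m' st' = ratr (reach rat j' m' st').
  elim: m' st' => [|m' IH] st' /=; case: ifP => _; rewrite ?rmorph1 ?rmorph0//.
  exact: hA.
elim: i st => [|i IH] st /=; case: ifP => _; rewrite ?rmorph0//.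
exact: hA.
Qed.

Section Bound.
Variable R : realType.

(** Stacks list the top first, so this forgets the [j] lowest levels and makes level [j] the
    root. *)
Definition upper (T : Type) j (S : seq T) := take (size S - j) S.

Lemma upper_cons (T : Type) j (x : T) S : (j <= size S)%N -> upper j (x :: S) = x :: upper j S.
Proof. by move=> jS; rewrite /upper /= subSn. Qed.

Lemma upper_nil (T : Type) j (S : seq T) : (size S <= j)%N -> upper j S = [::].
Proof. by rewrite /upper -subn_eq0 => /eqP ->; rewrite take0. Qed.

Lemma upper_pop j (F : seq (V * V)) S : (j <= size S)%N -> upper j (pop F S) = pop F (upper j S).
Proof.
case: S => [|G S] //=; rewrite leq_eqVlt => /orP[/eqP ->|jS].
  by rewrite !upper_nil.
by rewrite !upper_cons.
Qed.

(** The rate is 1 if level [j] has an edge leading back, whose use is then the killing, and 0 for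
    the first class of the path. *)
Lemma out_avg_le (g : lstate V -> R) phi j st F S :
  (forall st' S', lrep st' S' -> g st' <= phi (upper j S')) ->
  lrep st (F :: S) -> (j <= size S)%N ->
  out_avg g st <= stepop onward (j != 0)%N%:R phi (F :: upper j S).
Proof.
move=> gphi rp jS; have po := lrep_out rp; rewrite /out_avg (perm_big _ po) (perm_size po).
have hF : \sum_(f <- F) g (lstep nb st f) <= \sum_(f <- F) phi (push onward f F (upper j S)).
  rewrite !big_seq ler_sum// => f fF; have [_ rp'] := lrep_push rp fF.
  by apply: le_trans (gphi _ _ rp') _; rewrite /push !upper_cons//= leqW.
have szS : size S = size st.2.
  by case: rp => _ _ /matches_size; rewrite size_rev => -[].
move E: (st.2) szS => q; case/lastP: q E => [st2 S0|p [e X] st2 _].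
  (* Empty path: the only class has no edge leading back, and [j] is 0. *)
  rewrite /back st2 /=.
  have -> : S = [::] by apply: size0nil; rewrite S0.
  move: jS; rewrite S0 leqn0 => /eqP j0; rewrite j0/= mul0r add0r addr0.
  by rewrite ler_wpM2r ?invr_ge0//; move: hF; rewrite j0 (size0nil S0).
rewrite /back st2 rev_rcons /= big_cons.
have [_ rp'] : size (lstep nb st (flip e)).2 = size p /\
    lrep (lstep nb st (flip e)) (pop F S).
  move: rp st2; case: (st) => X0 q /= rp st2; move: rp; rewrite st2; exact: lrep_pop.
have hb : g (lstep nb st (flip e)) <= phi (pop F (upper j S)).
  by rewrite -upper_pop//; apply: gphi.
have -> : wt (j != 0)%N%:R (upper j S) = 1 :> R.
  case: j jS {gphi hF hb} => [_|j _]; last by case: (upper _ _).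
  case: S rp {rp'} => [|G S]; last by rewrite /upper subn0 take_size.
  by case=> _ _; rewrite st2 rev_rcons /=; case: (rev p) => [|[? ?] ?] [].
rewrite mul1r -natr1 ler_wpM2r ?invr_ge0//.
exact: lerD.
Qed.

(** The path is longer than [j] exactly as long as a level above [j] remains; each such level has an
    edge leading back, hence rate 1. *)
Lemma reach_kill j m st S : lrep st S ->
  reach R j m st <= kill onward 1 m (upper j.+1 S).
Proof.
elim: m st S => [|m IH] st S rp.
  rewrite /=; case: ifP => h; last by case: (_ == _).
  have szS : size S = (size st.2).+1.
    by case: rp => _ _ /matches_size; rewrite size_rev.
  by rewrite upper_nil// szS.
have szS : size S = (size st.2).+1.
  by case: rp => _ _ /matches_size; rewrite size_rev.
rewrite [reach _ _ _ _]/=; case: ifP => h.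
  by rewrite upper_nil ?kill_nil// szS.
case: S szS rp => // F S [szS] rp.
have jS : (j < size S)%N by rewrite szS ltnNge h.
by rewrite upper_cons// /kill iterS; apply: out_avg_le => // st' S'; apply: IH.
Qed.

Lemma dwell_visit j i m st S : lrep st S ->
  dwell R j i m st <= visit onward (j != 0)%N%:R i (upper j S).
Proof.
elim: i st S => [|i IH] st S rp.
  rewrite /=; case: ifP => h; first exact: expose_ge0.
  apply: (le_trans (reach_kill j m rp)).
  have szS : size S = (size st.2).+1.
    by case: rp => _ _ /matches_size; rewrite size_rev.
  case: S szS rp => // F S [szS] rp.
  have jS : (j <= size S)%N by rewrite szS leqNgt h.
  rewrite [X in expose _ _ X](upper_cons _ jS).
  (* [expose] removes the root of [upper j], which is level [j]. *)
  have -> : upper j.+1 (F :: S) = belast F (upper j S).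
    rewrite /upper /= subSS.
    move: (size S - j)%N (leq_subr j (size S)) => n.
    elim: n F S {szS jS rp} => [|n IH'] F [|G S] //= nS.
    by rewrite -IH'.
  exact: kill_le_lim.
have szS : size S = (size st.2).+1.
  by case: rp => _ _ /matches_size; rewrite size_rev.
rewrite [dwell _ _ _ _ _]/=; case: ifP => h.
  by apply: visit_ge0.
case: S szS rp => // F S [szS] rp.
have jS : (j <= size S)%N by rewrite szS leqNgt h.
by rewrite upper_cons// /visit iterS; apply: out_avg_le => // st' S'; apply: IH.
Qed.

Lemma dwell_small_pos j st S (e : R) : (0 < j)%N -> lrep st S -> 0 < e ->
  exists i, forall m, dwell R j i m st <= e.
Proof.
move=> j0 rp e0.
have [i hi] := @visit_small R _ onward 1 (upper j S) e ler01 (@recur_pos R _ onward 1 (upper j S) ltr01) e0.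
exists i => m; apply: le_trans hi; have := dwell_visit j i m rp.
by rewrite -lt0n j0.
Qed.

Lemma dwell_small_root x (c : V * V -> R) (e : R) : subsolution onward c ->
  0 < cond c (star x) -> 0 < e ->
  exists i, forall m, dwell R 0 i m (lstart x) <= e.
Proof.
move=> csub cx e0.
have [i hi] := @visit_small R _ onward 0 [:: star x] e (lexx 0) (recur0_root csub cx) e0.
by exists i => m; apply: le_trans hi; apply: (dwell_visit 0 i m (lrep_start x)).
Qed.

End Bound.

End LcrwStack.

Local Open Scope classical_set_scope.
Local Open Scope ring_scope.

(** * From finite-horizon bounds to almost sure convergence *)

Lemma negligible_small d (T : measurableType d) (R : realType)
    (mu : {measure set T -> \bar R}) (E : set T) :
  (forall e : R, 0 < e -> exists B, [/\ measurable B, E `<=` B & (mu B <= e%:E)%E]) ->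
  mu.-negligible E.
Proof.
move=> h; have /choice[B hB] (k : nat) : exists B,
    [/\ measurable B, E `<=` B & (mu B <= (k.+1%:R^-1)%:E)%E].
  by apply: h; rewrite invr_gt0.
have mB : measurable (\bigcap_k B k) by apply: bigcapT_measurable => k; case: (hB k).
exists (\bigcap_k B k); split=> //; last by move=> w Ew k _; case: (hB k) => _ + _; apply.
apply/eqP; rewrite eq_le measure_ge0 andbT; apply/lee_addgt0Pr => e e0; rewrite add0e.
pose k := Num.truncn e^-1.
have [mBk _ Bk] := hB k.
apply: (@le_trans _ _ (mu (B k))).
  by apply: le_measure; rewrite ?inE//; apply: bigcap_inf.
apply: (le_trans Bk); rewrite lee_fin invf_ple ?posrE//.
by rewrite ltW// truncnS_gt.
Qed.

Lemma bigcup_countType (T : Type) (I : countType) (A : I -> set T) :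
  \bigcup_i A i = \bigcup_k (if @unpickle I k is Some i then A i else set0).
Proof.
apply/seteqP; split=> w [].
  by move=> i _ Aw; exists (pickle i) => //; rewrite pickleK.
by move=> k _; case: unpickle => // i Aw; exists i.
Qed.

Lemma measurable_bigcup_countType d (T : measurableType d) (I : countType)
    (A : I -> set T) : (forall i, measurable (A i)) -> measurable (\bigcup_i A i).
Proof.
move=> mA; rewrite bigcup_countType; apply: bigcupT_measurable => k.
by case: unpickle.
Qed.

Lemma negligible_bigcup_countType d (T : measurableType d) (R : realType)
    (mu : {measure set T -> \bar R}) (I : countType) (A : I -> set T) :
  (forall i, mu.-negligible (A i)) -> mu.-negligible (\bigcup_i A i).
Proof.
move=> nA; rewrite bigcup_countType; apply: negligible_bigcup => k.
by case: unpickle => // ; exact: negligible_set0.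
Qed.

(** * Events along the walk *)

Section Prob.
Variables (V : countType) (nb : V -> seq V) (d : measure_display).
Variables (Omega : measurableType d) (R : realType) (P : probability Omega R).
Variables (x : V) (c : nat -> Omega -> V * V).
Hypothesis lc : is_lcrw nb P x c.

Let X n w := lrun nb x (history c n w).
Let L n w := size (X n w).2.

Lemma historyS n w : history c n.+1 w = rcons (history c n w) (c n w).
Proof. by rewrite /history -addn1 iotaD map_cat cats1. Qed.

Lemma size_history n w : size (history c n w) = n.
Proof. by rewrite size_map size_iota. Qed.

Lemma history_rcons n h e w :
  (history c n.+1 w = rcons h e) <-> (history c n w = h /\ c n w = e).
Proof. by rewrite historyS; split=> [/rcons_inj[]//|[-> ->]]. Qed.

Lemma measurable_history n h : measurable [set w | history c n w = h].
Proof.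
elim: n h => [|n IH] h.
  have [->|h0] := eqVneq h [::].
    by rewrite (_ : [set _ | _] = setT)//; apply/seteqP; split.
  rewrite (_ : [set _ | _] = set0)//; apply/seteqP; split=> // w /=.
  by rewrite /history /= => hE; rewrite -hE eqxx in h0.
case/lastP: h => [|h e].
  suff -> : [set w | history c n.+1 w = [::]] = set0 by [].
  by apply/seteqP; split=> // w /= hE; have := size_history n.+1 w; rewrite hE.
rewrite (_ : [set _ | _] = [set w | history c n w = h] `&` [set w | c n w = e]).
  by apply: measurableI => //; apply: lc.1.
by apply/seteqP; split=> w /= /history_rcons.
Qed.

Lemma measurable_history_pred n (phi : seq (V * V) -> Prop) :
  measurable [set w | phi (history c n w)].
Proof.
rewrite (_ : [set _ | _] = \bigcup_h [set w | phi h /\ history c n w = h]).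
  apply: measurable_bigcup_countType => h.
  have [ph|ph] := pselect (phi h).
    rewrite (_ : [set _ | _] = [set w | history c n w = h]).
      exact: measurable_history.
    by apply/seteqP; split=> w /=; [case|].
  by rewrite (_ : [set _ | _] = set0)//; apply/seteqP; split=> w //= -[].
apply/seteqP; split=> w /=; first by move=> h; exists (history c n w).
by move=> [h _ [ph hE]]; rewrite hE.
Qed.

Lemma measurable_off n h (o : seq (V * V)) :
  measurable [set w | history c n w = h /\ c n w \notin o].
Proof.
pose phi l := exists e : V * V, l = rcons h e /\ e \notin o.
rewrite (_ : [set _ | _] = [set w | phi (history c n.+1 w)]).
  exact: measurable_history_pred.
apply/seteqP; split=> w /=; first by case=> h1 h2; exists (c n w); rewrite historyS h1.
by case=> e [/history_rcons[-> ->]].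
Qed.

Lemma measure_bigU_le (I : eqType) (s : seq I) (A : I -> set Omega) :
  (forall i, measurable (A i)) ->
  (P (\big[setU/set0]_(i <- s) A i) <= \sum_(i <- s) P (A i))%E.
Proof.
move=> mA; elim: s => [|i s IH]; first by rewrite !big_nil measure0.
rewrite !big_cons; apply: le_trans (measureU2 _ _ _) _ => //.
  exact: bigsetU_measurable.
exact: leeD2l.
Qed.

Lemma choice_null n h : size h = n ->
  P [set w | history c n w = h /\ c n w \notin out_edges nb (cur (lrun nb x h))] = 0%E.
Proof.
move=> hn; set o := out_edges nb _.
have mE := measurable_off n h o.
apply/negligibleP => //.
apply: (@negligibleS _ _ _ _ (\bigcup_e
   (if e \notin o then [set w | history c n w = h /\ c n w = e] else set0))).
  by move=> w /= [h1 h2]; exists (c n w) => //; rewrite h2.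
apply: negligible_bigcup_countType => e.
case: ifPn => eo; last exact: negligible_set0.
apply/negligibleP.
  by apply: measurableI; [exact: measurable_history|exact: lc.1].
apply: etrans (lc.2 n h e hn) _.
by rewrite /lchoice_prob -/o (negbTE eo) mule0.
Qed.

(** Total probability over the next edge; the event that it is not an out-edge is null by
    [choice_null]. *)
Lemma one_step_le n h (A : set Omega) (g : lstate V -> R) : size h = n ->
  measurable A -> (forall s, 0 <= g s) ->
  (forall e, (P ([set w | history c n.+1 w = rcons h e] `&` A) <=
     P [set w | history c n.+1 w = rcons h e] * (g (lrun nb x (rcons h e)))%:E)%E) ->
  (P ([set w | history c n w = h] `&` A) <=
   P [set w | history c n w = h] * (out_avg nb g (lrun nb x h))%:E)%E.
Proof.
move=> hn mA g0 hA; set o := out_edges nb (cur (lrun nb x h)).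
have mB e : measurable ([set w | history c n.+1 w = rcons h e] `&` A).
  by apply: measurableI => //; apply: measurable_history.
have mN := measurable_off n h o.
pose U := \big[setU/set0]_(e <- o) ([set w | history c n.+1 w = rcons h e] `&` A).
have mU : measurable U by apply: bigsetU_measurable.
apply: (@le_trans _ _ (P (U `|` [set w | history c n w = h /\ c n w \notin o]))).
  apply: le_measure; rewrite ?inE.
  - by apply: measurableI => //; apply: measurable_history.
  - exact: measurableU.
  move=> w /= [h1 Aw]; have [co|co] := boolP (c n w \in o); last by right.
  left; rewrite /U -bigcup_seq; exists (c n w) => //=; split=> //.
  by rewrite historyS h1.
apply: le_trans (measureU2 _ mU mN) _.
apply: le_trans (leeD (measure_bigU_le o mB) (lexx _)) _.
rewrite [X in (_ + X)%E](choice_null hn) adde0.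
have pE : P [set w | history c n w = h] = (fine (P [set w | history c n w = h]))%:E.
  by rewrite fineK// fin_num_measure//; apply: measurable_history.
rewrite pE; set p := fine _; have p0 : 0 <= p by apply: fine_ge0.
apply: (@le_trans _ _ (\sum_(e <- o) (p * (size o)%:R^-1 * g (lstep nb (lrun nb x h) e))%:E)%E).
  rewrite !big_seq; apply: lee_sum => e eo; apply: le_trans (hA e) _.
  rewrite (_ : [set w | history c n.+1 w = rcons h e] = [set w | history c n w = h /\ c n w = e]).
    rewrite (lc.2 n h e hn) pE /lchoice_prob -/o eo -!EFinM.
    by rewrite /lrun foldl_rcons.
  by apply/seteqP; split=> w /= /history_rcons.
rewrite sumEFin -EFinM lee_fin /out_avg -/o -mulr_sumr.
by rewrite [X in _ <= _ * X]mulrC mulrA.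
Qed.

(** [hits] and [stays] are the events, from time [n] on, whose conditional probabilities [reach] and
    [dwell] bound. *)
Fixpoint hits j m n w : bool :=
  (L n w <= j)%N || (if m is m'.+1 then hits j m' n.+1 w else false).

Fixpoint stays j i m n w : bool :=
  (j <= L n w)%N && (if i is i'.+1 then stays j i' m n.+1 w else hits j m n w).

Lemma measurable_L n (p : pred nat) : measurable [set w | p (L n w)].
Proof. exact: (measurable_history_pred n (fun h => p (size (lrun nb x h).2))). Qed.

Lemma measurable_hits j m n : measurable [set w | hits j m n w].
Proof.
elim: m n => [|m IH] n /=.
  under eq_set do rewrite orbF; exact: (measurable_L n (fun l => l <= j)%N).
rewrite (_ : [set _ | _] = [set w | (L n w <= j)%N] `|` [set w | hits j m n.+1 w]).
  by apply: measurableU => //; exact: (measurable_L n (fun l => l <= j)%N).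
by apply/seteqP; split=> w /= /orP.
Qed.

Lemma measurable_stays j i m n : measurable [set w | stays j i m n w].
Proof.
elim: i n => [|i IH] n /=.
  rewrite (_ : [set _ | _] = [set w | (j <= L n w)%N] `&` [set w | hits j m n w]).
    by apply: measurableI; [exact: (measurable_L n (fun l => j <= l)%N)|exact: measurable_hits].
  by apply/seteqP; split=> w /= /andP.
rewrite (_ : [set _ | _] = [set w | (j <= L n w)%N] `&` [set w | stays j i m n.+1 w]).
  by apply: measurableI => //; exact: (measurable_L n (fun l => j <= l)%N).
by apply/seteqP; split=> w /= /andP.
Qed.

Lemma prob_setI_le n h A : measurable A ->
  (P ([set w | history c n w = h] `&` A) <= P [set w | history c n w = h])%E.
Proof.
move=> mA; apply: le_measure; rewrite ?inE.
- by apply: measurableI => //; apply: measurable_history.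
- exact: measurable_history.
by move=> w [].
Qed.

Lemma prob_hits j m n h : size h = n ->
  (P ([set w | history c n w = h] `&` [set w | hits j m n w]) <=
   P [set w | history c n w = h] * (reach nb R j m (lrun nb x h))%:E)%E.
Proof.
elim: m n h => [|m IH] n h hn.
  rewrite [reach _ _ _ _ _]/=; case: ifP => hj.
    by rewrite mule1; apply: prob_setI_le; apply: measurable_hits.
  rewrite mule0 (_ : _ `&` _ = set0) ?measure0//; apply/seteqP; split=> // w /= [hw].
  by rewrite /L /X hw hj.
rewrite [reach _ _ _ _ _]/=; case: ifP => hj.
  by rewrite mule1; apply: prob_setI_le; apply: measurable_hits.
rewrite (_ : _ `&` _ = [set w | history c n w = h] `&` [set w | hits j m n.+1 w]).
  apply: one_step_le => //; first exact: measurable_hits.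
    by move=> s; apply: reach_ge0.
  by move=> e; apply: IH; rewrite size_rcons hn.
by apply/seteqP; split=> w /= [hw]; rewrite /L /X hw hj.
Qed.

Lemma prob_stays j i m n h : size h = n ->
  (P ([set w | history c n w = h] `&` [set w | stays j i m n w]) <=
   P [set w | history c n w = h] * (dwell nb R j i m (lrun nb x h))%:E)%E.
Proof.
elim: i n h => [|i IH] n h hn.
  rewrite [dwell _ _ _ _ _ _]/=; case: ifP => hj.
    rewrite mule0 (_ : _ `&` _ = set0) ?measure0//; apply/seteqP; split=> // w /= [hw].
    by rewrite /L /X hw leqNgt hj.
  apply: le_trans (prob_hits j m hn); apply: le_measure; rewrite ?inE.
  - by apply: measurableI; [exact: measurable_history|exact: (measurable_stays j 0)].
  - by apply: measurableI; [exact: measurable_history|exact: measurable_hits].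
  by move=> w /= [hw /andP[_ hh]].
rewrite [dwell _ _ _ _ _ _]/=; case: ifP => hj.
  rewrite mule0 (_ : _ `&` _ = set0) ?measure0//; apply/seteqP; split=> // w /= [hw].
  by rewrite /L /X hw leqNgt hj.
rewrite (_ : _ `&` _ = [set w | history c n w = h] `&` [set w | stays j i m n.+1 w]).
  apply: one_step_le => //; first exact: measurable_stays.
    by move=> s; apply: dwell_ge0.
  by move=> e; apply: IH; rewrite size_rcons hn.
by apply/seteqP; split=> w /= [hw]; rewrite /L /X hw leqNgt hj.
Qed.

Lemma hits_mono j m n w : hits j m n w -> hits j m.+1 n w.
Proof. by elim: m n => [|m IH] n /= /orP[->//|] // /IH /= ->; rewrite orbT. Qed.

Lemma stays_mono j i m n w : stays j i m n w -> stays j i m.+1 n w.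
Proof.
elim: i n => [|i IH] n /= /andP[-> //].
  exact: hits_mono.
exact: IH.
Qed.

Lemma hits_intro j m n w t : (t <= m)%N -> (L (n + t) w <= j)%N -> hits j m n w.
Proof.
elim: m n t => [|m IH] n [|t] //=; rewrite ?addn0.
- by move=> _ ->.
- by move=> _ ->.
- by rewrite ltnS addnS -addSn => tm h; rewrite (IH n.+1 t tm h) orbT.
Qed.

Lemma stays_intro j i m n w : (forall t, (n <= t)%N -> (j <= L t w)%N) ->
  hits j m (n + i) w -> stays j i m n w.
Proof.
elim: i n => [|i IH] n h hh; rewrite /= h//=; first by rewrite addn0 in hh.
apply: IH; last by rewrite addSn -addnS.
by move=> t /ltnW; apply: h.
Qed.

(** The event lies in the increasing union over [m] of the sets [D m]; since [i] is chosen before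
    [m], the bound [e] passes to the union. *)
Lemma negligible_recurrent j n h :
  (forall e : R, 0 < e -> exists i, forall m, dwell nb R j i m (lrun nb x h) <= e) ->
  P.-negligible [set w | [/\ history c n w = h,
     (forall t, (n <= t)%N -> (j <= L t w)%N) &
     (forall t, exists2 t', (t <= t')%N & (L t' w <= j)%N)]].
Proof.
move=> hd; apply: negligible_small => e e0; have [i hi] := hd e e0.
have [hn|hn] := eqVneq (size h) n; last first.
  exists set0; rewrite measure0 lee_fin ltW//; split=> // w /= [hw].
  by move: hn; rewrite -hw size_history eqxx.
pose D m := [set w | history c n w = h] `&` [set w | stays j i m n w].
have mD m : measurable (D m).
  by apply: measurableI; [exact: measurable_history|exact: measurable_stays].
have mU : measurable (\bigcup_m D m) by apply: bigcupT_measurable.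
exists (\bigcup_m D m); split=> //.
  move=> w /= [hw h1 h2]; have [t' tt' Lt'] := h2 (n + i)%N.
  exists (t' - (n + i))%N => //; split=> //=; apply: stays_intro => //.
  by apply: (@hits_intro _ _ _ _ (t' - (n + i))%N) => //; rewrite subnKC.
have ndD : nondecreasing_seq D.
  apply/nondecreasing_seqP => m; apply/subsetPset => w /= [hw hs]; split=> //.
  exact: stays_mono.
have hc : (P \o D) m @[m --> \oo] --> P (\bigcup_m D m).
  exact: nondecreasing_cvg_mu.
have hl : limn (P \o D) = P (\bigcup_m D m) by apply: cvg_lim hc.
have : (limn (P \o D) <= e%:E)%E; last by rewrite hl.
apply: lime_le; first by apply: cvgP hc.
near=> m; rewrite /=; apply: le_trans (prob_stays j i m hn) _.
apply: (@le_trans _ _ (1 * e%:E)%E); last by rewrite mul1e.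
apply: lee_pmul => //; first by rewrite lee_fin dwell_ge0.
  by apply: probability_le1; apply: measurable_history.
by rewrite lee_fin.
Unshelve. all: by end_near. Qed.

Lemma path_edges_lstep k (st : lstate V) e :
  (k <= size st.2)%N -> (k <= size (lstep nb st e).2)%N ->
  take k (path_edges (lstep nb st e)) = take k (path_edges st).
Proof.
rewrite /lstep /path_edges; case: ifP => // _; case: ifP => [|_]; last first.
  by move=> kst _; rewrite /= map_rcons -cats1 takel_cat// size_map.
set j := find _ _ => js; case: ifP => [_ _|j0 _].
  by rewrite /= leqn0 => /eqP ->; rewrite !take0.
(* Classes are counted from the starting one, so class [j] is entered by edge [j.-1]. *)
have jk : (j.-1 < size st.2)%N.
  by move: js; rewrite /path_classes /= size_map; case: (j) j0.
rewrite /= size_rcons size_take jk prednK ?lt0n ?j0// => kj.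
rewrite map_rcons -[RHS]/(take k (map fst st.2)).
have -> : rcons [seq i.1 | i <- take j.-1 st.2] (nth (e, [::]) st.2 j.-1).1 = take j (map fst st.2).
  rewrite -[j in RHS]prednK ?lt0n ?j0// (take_nth e) ?size_map// map_take.
  by rewrite (nth_map (e, [::])).
by rewrite take_takel.
Qed.

(** Let j be the lower limit of the length. If it is infinite the path converges; otherwise the
    length is eventually at least j and infinitely often at most j, which is a null event for each
    time and history. *)
Lemma lcrw_converges :
  (forall j h e, (0 < j)%N -> 0 < e ->
     exists i, forall m, dwell nb R j i m (lrun nb x h) <= e) ->
  (forall e, 0 < e -> exists i, forall m, dwell nb R 0 i m (lstart x) <= e) ->
  {ae P, forall w, path_converges (fun i => path_edges (lrun nb x (history c i w)))}.
Proof.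
move=> hpos hroot.
pose Bad j n h := [set w | [/\ history c n w = h,
     (forall t, (n <= t)%N -> (j <= L t w)%N) &
     (forall t, exists2 t', (t <= t')%N & (L t' w <= j)%N)]].
(* For [j = 0] the length is at least [j] from the start, so the empty history suffices. *)
apply: (@negligibleS _ _ _ _ (\bigcup_(a : nat * nat * seq (V * V))
    (if (0 < a.1.1)%N || (a.2 == [::]) then Bad a.1.1 a.1.2 a.2 else set0))); last first.
  apply: negligible_bigcup_countType => -[[j n] h] /=.
  case: ifP => [|_]; last exact: negligible_set0.
  have [->|j0] := posnP j => /= h0.
    by rewrite (eqP h0); apply: negligible_recurrent.
  by apply: negligible_recurrent => e; apply: hpos.
move=> w /= nconv.
pose io j := forall t, exists2 t', (t <= t')%N & (L t' w <= j)%N.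
have nio j : ~ io j -> exists n, forall t, (n <= t)%N -> (j < L t w)%N.
  move=> /existsNP[n hn]; exists n => t nt; rewrite ltnNge; apply/negP => Ltj.
  by apply: hn; exists t.
have [j0 hj0] : exists j, `[< io j >].
  apply: contrapT => /forallNP hio; apply: nconv => k.
  have [n hn] : exists n, forall t, (n <= t)%N -> (k < L t w)%N.
    by apply: nio => h; apply: (hio k); apply/asboolP.
  exists n => i ni; split; last first.
    by rewrite /path_edges size_map ltnW//; apply: hn.
  elim: i ni => [|i IH]; first by rewrite leqn0 => /eqP ->.
  rewrite leq_eqVlt => /orP[/eqP -> //|]; rewrite ltnS => ni; rewrite -(IH ni).
  have := hn i ni; have := hn i.+1 (leqW ni).
  rewrite /L /X historyS /lrun foldl_rcons -/(lrun nb x (history c i w)) => h1 h2.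
  by apply: path_edges_lstep; apply: ltnW.
have [j /asboolP hj jmin] := ex_minnP (ex_intro (fun j => `[< io j >]) j0 hj0).
have [jE|jpos] := posnP j.
  exists (j, 0%N, [::]) => //=; rewrite orbT.
  by split=> // t _; rewrite jE.
have [n hn] : exists n, forall t, (n <= t)%N -> (j.-1 < L t w)%N.
  apply: nio => /asboolP /jmin; rewrite -ltnS prednK// ltnn.
  by [].
exists (j, n, history c n w) => //=; rewrite jpos.
by split=> // t /hn; rewrite prednK.
Qed.

End Prob.

(** * Subdivisions *)

(** The side of [b] is what [b] reaches without the edge [ab]; if it contained [a], a simple path
    from [b] to [a] would close a cycle. *)
Lemma acyclic_cuts (V : countType) (nb : V -> seq V) :
  (forall x, x \notin nb x) -> (forall x y, y \in nb x -> x \in nb y) ->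
  acyclic nb -> has_cuts nb.
Proof.
move=> irr sym acy a b ab.
pose e c d := [&& d \in nb c, (c, d) != (a, b) & (c, d) != (b, a)].
have eS c d : e c d -> e d c.
  case/and3P => dc h1 h2; apply/and3P; split; first exact: sym.
  - by apply: contra h2 => /eqP[-> ->].
  - by apply: contra h1 => /eqP[-> ->].
pose s v := `[< exists p, path e b p /\ last b p = v >].
have sb : s b by apply/asboolP; exists [::].
have sa : s a = false.
  apply/negbTE/negP => /asboolP[p [pp]]; case/shortenP: pp => p' pp' up' _ pa.
  have ba : b != a by apply: contraL ab => /eqP ->.
  apply: (acy b p'); split=> //.
  (* The path is not the removed edge alone, so the cycle has at least three vertices. *)
  - case: p' pp' up' pa => [|z [|z' p']] //=; first by move=> _ _ /eqP; rewrite (negbTE ba).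
    by move=> + _ za; rewrite za andbT => /and3P[_ _ /eqP].
  - by apply: sub_path pp' => c d /and3P[].
  - by rewrite pa.
exists s; split; first by rewrite sa sb.
have half c d : e c d -> s c -> s d.
  move=> ecd /asboolP[p [pp pc]]; apply/asboolP; exists (rcons p d).
  by rewrite rcons_path pp pc last_rcons.
move=> c d cd /eqP h1 /eqP h2; have ecd : e c d by apply/and3P.
apply/idP/idP; apply: half => //; exact: eS.
Qed.

(** * Consecutive entries of a sequence *)

Section Consecutive.
Variable T : eqType.
Implicit Types (a b x : T) (s : seq T).

Lemma consecutive_cons a b x y s :
  consecutive a b (x :: y :: s) = (a == x) && (b == y) || consecutive a b (y :: s).
Proof. by rewrite /consecutive /= inE xpair_eqE. Qed.

Lemma consecutiveP a b s : uniq s ->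
  reflect (exists2 i, (i.+1 < size s)%N & a = nth a s i /\ b = nth a s i.+1) (consecutive a b s).
Proof.
move=> us; apply: (iffP idP).
  elim: s {us} => // x [|y s] IH //; rewrite consecutive_cons.
  case/orP=> [/andP[/eqP -> /eqP ->]|/IH[i h1 [h2 h3]]]; first by exists 0%N.
  by exists i.+1.
case=> i; elim: s i {us} => // x [|y s] IH // [|i] /= h [h1 h2]; rewrite consecutive_cons.
  by rewrite h1 h2 !eqxx.
by rewrite (IH i) ?orbT.
Qed.

Lemma consecutive_mem a b s : consecutive a b s -> a \in s /\ b \in s.
Proof.
elim: s => // x [|y s] IH //; rewrite consecutive_cons.
case/orP=> [/andP[/eqP -> /eqP ->]|/IH[h1 h2]]; first by rewrite !inE !eqxx orbT.
by rewrite inE h1 orbT inE h2 orbT.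
Qed.

Lemma consecutive_index a b s : uniq s -> consecutive a b s -> index b s = (index a s).+1.
Proof.
elim: s => // x [|y s] IH // /= /andP[xys us]; rewrite consecutive_cons.
case/orP=> [/andP[/eqP -> /eqP ->]|h].
  by rewrite !eqxx; move: xys; rewrite inE negb_or eq_sym => /andP[/negbTE -> _].
have [ha hb] := consecutive_mem h.
have xa : (x == a) = false by apply: contraNF xys => /eqP ->.
have xb : (x == b) = false by apply: contraNF xys => /eqP ->.
by rewrite xa xb; congr S; apply: IH.
Qed.

Lemma consecutive_rcons a b s x y :
  consecutive a b (rcons (rcons s x) y) = consecutive a b (rcons s x) || ((a == x) && (b == y)).
Proof.
elim: s => [|z [|w s] IH] /=; first by rewrite consecutive_cons /consecutive /= orbC.
  by rewrite !consecutive_cons /consecutive /= !orbF.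
by move: IH; rewrite /= !consecutive_cons => ->; rewrite orbA.
Qed.

Lemma consecutive_rev a b s : consecutive a b (rev s) = consecutive b a s.
Proof.
elim: s => // x [|y s] IH //; rewrite consecutive_cons !rev_cons consecutive_rcons -rev_cons IH.
by rewrite orbC andbC.
Qed.

Lemma consecutive_path (e : rel T) a b x s : path e x s -> consecutive a b (x :: s) -> e a b.
Proof.
elim: s x => // y s IH x /= /andP[exy pys]; rewrite consecutive_cons.
by case/orP=> [/andP[/eqP -> /eqP ->]//|]; apply: IH.
Qed.

End Consecutive.

(** * Edges and cuts of a subdivision *)

Section Subdivision.
Variables (V V' : countType) (nb : V -> seq V) (nb' : V' -> seq V').
Variables (io : V -> V') (p : V -> V -> seq V').
Hypothesis irr : forall x, x \notin nb x.
Hypothesis sym : forall x y, y \in nb x -> x \in nb y.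
Hypothesis nb_uniq : forall x, uniq (nb x).
Hypothesis sd : subdivision_data nb nb' io p.

Definition full u v := io u :: rcons (p u v) (io v).

Let io_inj : injective io := let: conj (And4 h _ _ _) _ := sd in h.

Let p_rev u v : v \in nb u -> p v u = rev (p u v) := let: conj (And4 _ h _ _) _ := sd in h u v.

Let p_path u v : v \in nb u -> path (adj nb') (io u) (rcons (p u v) (io v)) :=
  let: conj (And4 _ _ h _) _ := sd in h u v.

Let p_uniq u v : v \in nb u -> uniq (p u v) := let: conj (And4 _ _ _ h) _ := sd in h u v.

Let p_io u v w : v \in nb u -> io w \notin p u v.
Proof.
move=> uv; apply/negP => h; have [_ [hn _ _ _]] := sd.
by have := hn u v (io w) uv h w; rewrite eqxx.
Qed.

Let p_disj u v u' v' a : v \in nb u -> v' \in nb u' -> a \in p u v -> a \in p u' v' ->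
  (u' = u /\ v' = v) \/ (u' = v /\ v' = u) := let: conj _ (And4 _ h _ _) := sd in h u v u' v' a.

Let edge_full a b : b \in nb' a -> exists u v, v \in nb u /\ consecutive a b (full u v) :=
  let: conj _ (And4 _ _ _ h) := sd in h a b.

Lemma full_uniq u v : v \in nb u -> uniq (full u v).
Proof.
move=> uv; rewrite /full /= rcons_uniq p_io// p_uniq// mem_rcons inE negb_or p_io// !andbT.
by apply: contraL uv => /eqP/io_inj ->.
Qed.

Lemma full_rev u v : v \in nb u -> full v u = rev (full u v).
Proof. by move=> uv; rewrite /full rev_cons rev_rcons p_rev. Qed.

Lemma io_in_full w u v : v \in nb u -> io w \in full u v -> w = u \/ w = v.
Proof.
move=> uv; rewrite /full inE mem_rcons inE (negbTE (p_io _ uv)) orbF.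
by case/orP=> /eqP/io_inj ->; [left|right].
Qed.

Lemma consecutive_index_lt a b u v : v \in nb u -> consecutive a b (full u v) ->
  (index a (full u v) <= size (p u v))%N.
Proof.
move=> uv ab; have [_ bf] := consecutive_mem ab.
by move: bf; rewrite -index_mem (consecutive_index (full_uniq uv) ab) /= size_rcons.
Qed.

Lemma index_first u v : index (io u) (full u v) = 0%N.
Proof. by rewrite /full /= eqxx. Qed.

Lemma index_last u v : v \in nb u -> index (io v) (full u v) = (size (p u v)).+1.
Proof.
move=> uv; rewrite /full /=; have /negbTE -> : io u != io v.
  by apply: contraL uv => /eqP/io_inj ->.
by rewrite -cats1 index_cat (negbTE (p_io _ uv)) /= eqxx addn0.
Qed.

Lemma consecutive_flip a b u v : v \in nb u -> consecutive a b (full u v) ->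
  ~ consecutive a b (full v u).
Proof.
move=> uv ab; rewrite full_rev// consecutive_rev => ba.
have := consecutive_index (full_uniq uv) ab; rewrite (consecutive_index (full_uniq uv) ba).
by move=> /eqP; rewrite -addn2 -[X in X == _]addn0 eqn_add2l.
Qed.

(** An inner vertex determines its subdivided edge up to orientation, and consecutive entries fix
    the orientation. If neither [a] nor [b] is inner, they are the two ends. *)
Lemma edge_unique a b u v u' v' : v \in nb u -> v' \in nb u' ->
  consecutive a b (full u v) -> consecutive a b (full u' v') -> u' = u /\ v' = v.
Proof.
move=> uv uv' ab ab'; have [aM bM] := consecutive_mem ab; have [aM' bM'] := consecutive_mem ab'.
have bad : ~ (u' = v /\ v' = u).
  by case=> ? ?; subst; apply: (consecutive_flip uv ab).
have inner y : y \in full u v -> y \in full u' v' -> (forall w, y <> io w) -> u' = u /\ v' = v.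
  rewrite /full !inE !mem_rcons !inE => h h' nio.
  have hp : y \in p u v by case/or3P: h => // /eqP /nio.
  have hp' : y \in p u' v' by case/or3P: h' => // /eqP /nio.
  by case: (p_disj uv uv' hp hp').
have [[w wE]|na] := pselect (exists w, a = io w); last first.
  by apply: (inner a) => // w wE; apply: na; exists w.
have [[z zE]|nz] := pselect (exists z, b = io z); last first.
  by apply: (inner b) => // z zE; apply: nz; exists z.
have tail u1 v1 : v1 \in nb u1 -> consecutive a b (full u1 v1) -> w = u1.
  move=> h c1; have [aM1 _] := consecutive_mem c1; subst a.
  case: (io_in_full h aM1) => // wv; have := consecutive_index_lt h c1.
  by rewrite wv index_last// ltnn.
have head u1 v1 : v1 \in nb u1 -> consecutive a b (full u1 v1) -> z = v1.
  move=> h c1; have [_ bM1] := consecutive_mem c1; subst b.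
  case: (io_in_full h bM1) => // zu; have := consecutive_index (full_uniq h) c1.
  by rewrite zu index_first.
by rewrite -(tail _ _ uv ab) -(tail _ _ uv' ab') -(head _ _ uv ab) -(head _ _ uv' ab').
Qed.

(** If [ab] lies on the subdivided edge [uv], the cut of [uv] is kept elsewhere, and along
    [full u v] the colour changes exactly between [a] and [b]. *)
Lemma subdivision_cuts : has_cuts nb -> has_cuts nb'.
Proof.
move=> cuts a b /edge_full[u [v [uv ab]]].
have [s [suv sc]] := cuts u v uv.
(* Inner vertices take the colour of an end of their edge; for edges other than [uv] both ends have
   the same colour. *)
pose S y := `[< (exists w, y = io w /\ s w) \/
  (exists u' v', [/\ v' \in nb u', y \in p u' v' & s u']) >].
pose s' y := if y \in full u v then
  if (index y (full u v) <= index a (full u v))%N then s u else s v else S y.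
have uf := full_uniq uv.
have [aM bM] := consecutive_mem ab; have ab1 := consecutive_index uf ab.
have S_io w : S (io w) = s w.
  apply/idP/idP => [/asboolP[[w' [/io_inj -> //]]|[u' [v' [h h' _]]]]|sw].
    by have := p_io w h; rewrite h'.
  by apply/asboolP; left; exists w.
have s_io w : s' (io w) = s w.
  rewrite /s'; case: ifP => [/(io_in_full uv)[->|->]|_]; last exact: S_io.
    by rewrite index_first.
  rewrite index_last// leqNgt ltnS; have := consecutive_index_lt uv ab.
  by move=> ->.
have off u' v' y : v' \in nb u' -> (u', v') <> (u, v) -> (u', v') <> (v, u) ->
    y \in full u' v' -> s' y = s u'.
  move=> uv' n1 n2; have ss : s u' = s v' by apply: sc.
  rewrite inE mem_rcons inE => /or3P[/eqP ->|/eqP ->|yp]; rewrite ?s_io//.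
  have yN : y \notin full u v.
    rewrite /full inE mem_rcons inE; apply/negP => /or3P[/eqP E|/eqP E|yp'].
    - by have := p_io u uv'; rewrite -E yp.
    - by have := p_io v uv'; rewrite -E yp.
    - by case: (p_disj uv uv' yp' yp) => -[? ?]; subst.
  rewrite /s' (negbTE yN); apply/idP/idP => [/asboolP[[w [E _]]|[u1 [v1 [h1 yp1 su1]]]]|su'].
  - by have := p_io w uv'; rewrite -E yp.
  - by case: (p_disj h1 uv' yp1 yp) => -[E1 E2]; [rewrite E1|rewrite ss E2].
  - by apply/asboolP; right; exists u', v'.
have on c d' : consecutive c d' (full u v) -> (c, d') <> (a, b) -> s' c = s' d'.
  move=> cd ne; have [cM dM] := consecutive_mem cd.
  rewrite /s' cM dM (consecutive_index uf cd).
  have [h|h|h] := ltngtP (index c (full u v)) (index a (full u v)) => //.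
  case: ne; have ca : c = a by rewrite -(nth_index a cM) h nth_index.
  subst c; congr pair; rewrite -(nth_index a dM) (consecutive_index uf cd) -ab1.
  by rewrite nth_index.
exists s'; split.
  by rewrite /s' aM bM leqnn ab1 ltnn.
move=> c d' /edge_full[u' [v' [uv' cd]]] n1 n2.
have [E1|E1] := pselect ((u', v') = (u, v)).
  by case: E1 => ? ?; subst; apply: on.
have [E2|E2] := pselect ((u', v') = (v, u)).
  case: E2 => ? ?; subst; move: cd; rewrite full_rev// consecutive_rev => cd.
  by apply/esym/on => // -[? ?]; subst.
have [cM dM] := consecutive_mem cd.
by rewrite (off _ _ _ uv' E1 E2 cM) (off _ _ _ uv' E1 E2 dM).
Qed.

(** * Conductances on a subdivision *)

Section SubCond.
Variables (R : realType) (c : V * V -> R) (M : nat).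
Hypothesis csub : subsolution (onward nb) c.
Hypothesis pM : forall u v, v \in nb u -> (size (p u v) < M)%N.
Hypothesis nb'_uniq : forall x, uniq (nb' x).

(* Each edge of weight c becomes a series of edges with resistances
   M/c, M/c - 1, M/c - 2, ... as seen from its consecutive vertices. *)
Definition subcond (f : V' * V') : R :=
  if pselect (exists uv : V * V, uv.2 \in nb uv.1 /\ consecutive f.1 f.2 (full uv.1 uv.2))
    is left h then
      let uv := projT1 (cid h) in
      c uv / (M%:R - (index f.1 (full uv.1 uv.2))%:R * c uv)
  else 0.

Lemma subcondE a b u v : v \in nb u -> consecutive a b (full u v) ->
  subcond (a, b) = c (u, v) / (M%:R - (index a (full u v))%:R * c (u, v)).
Proof.
move=> uv ab; rewrite /subcond; case: pselect => [h|[]]; last by exists (u, v).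
case: (cid h) => -[u' v'] /= [uv' ab'].
by have [-> ->] := edge_unique uv uv' ab ab'.
Qed.

Lemma sub_ge0 f : 0 <= c f. Proof. by case: (csub f). Qed.

Lemma sub_lt1 f : c f < 1.
Proof. by have [c0 h] := csub f; have := cond_ge0 csub (onward nb f); nra. Qed.

Lemma subcond_den u v i : (i < M)%N -> 0 < M%:R - i%:R * c (u, v) :> R.
Proof.
move=> iM; have h : i%:R < M%:R :> R by rewrite ltr_nat.
have i0 : 0 <= i%:R :> R by [].
by have := sub_ge0 (u, v); have := sub_lt1 (u, v); nra.
Qed.

Lemma subcond_ge0 f : 0 <= subcond f.
Proof.
case: f => a b; have [[[u v] [uv ab]]|h] := pselect (exists uv : V * V,
    uv.2 \in nb uv.1 /\ consecutive a b (full uv.1 uv.2)).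
  rewrite (subcondE uv ab) divr_ge0 ?sub_ge0// ltW// subcond_den//.
  by apply: leq_ltn_trans (pM uv); apply: consecutive_index_lt ab.
by rewrite /subcond; case: pselect.
Qed.

Lemma cond_subset (I : eqType) (g : I -> R) (s t : seq I) : uniq s -> uniq t ->
  (forall i, 0 <= g i) -> {subset s <= t} -> cond g s <= cond g t.
Proof.
move=> us ut g0 st; rewrite /cond [leRHS](bigID (mem s))/= -[leLHS]addr0 lerD ?sumr_ge0//.
rewrite -[X in _ <= X]big_filter (perm_big [seq i <- t | i \in s])//.
apply: uniq_perm => //; first exact: filter_uniq.
by move=> i; rewrite mem_filter; case: (boolP (i \in s)) => // /st ->.
Qed.

Definition first u v := nth (io u) (full u v) 1.

Lemma consecutive_first u v : v \in nb u -> consecutive (io u) (first u v) (full u v).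
Proof.
move=> uv; apply/(consecutiveP _ _ (full_uniq uv)); exists 0%N => //=.
by rewrite size_rcons.
Qed.

Lemma consecutive_adj a b u v : v \in nb u -> consecutive a b (full u v) -> b \in nb' a.
Proof. by move=> uv; apply: (consecutive_path (p_path uv)). Qed.

Lemma subcond_first u v : v \in nb u -> subcond (io u, first u v) = c (u, v) / M%:R.
Proof.
move=> uv; rewrite (subcondE uv (consecutive_first uv)) index_first.
by rewrite mul0r subr0.
Qed.

Lemma subsolution_subcond : subsolution (onward nb') subcond.
Proof.
move=> [a b]; split; first exact: subcond_ge0.
have C0 : 0 <= cond subcond (onward nb' (a, b)).
  by apply: sumr_ge0 => f _; apply: subcond_ge0.
have [[[u v] /= [uv ab]]|h] := pselect (exists uv : V * V,
    uv.2 \in nb uv.1 /\ consecutive a b (full uv.1 uv.2)); last first.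
  by rewrite {1}/subcond; case: pselect => // _; rewrite mul0r.
have uf := full_uniq uv; have [aM bM] := consecutive_mem ab.
have ab1 := consecutive_index uf ab.
have iL := consecutive_index_lt uv ab; have LM := pM uv.
rewrite (subcondE uv ab).
set i := index a _ in iL ab1 *.
have d0 := @subcond_den u v i (leq_ltn_trans iL LM).
have c0 := sub_ge0 (u, v); have c1 := sub_lt1 (u, v).
set C := cond _ _ in C0 *.
(* In resistances: what lies behind [b] has resistance at most M/c - (i + 1), one less than the M/c
   - i of [ab]. *)
suff h : c (u, v) <= C * (M%:R - i.+1%:R * c (u, v)).
  rewrite mulrAC ler_pdivrMr//; move: h; rewrite -natr1; nra.
move: iL; rewrite leq_eqVlt => /orP[/eqP iE|iL]; last first.
  (* Inside the path, the next edge has exactly that resistance. *)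
  have nM : (i.+2 < size (full u v))%N by rewrite /= size_rcons ltnS.
  pose e := nth a (full u v) i.+2.
  have be : consecutive b e (full u v).
    apply/(consecutiveP _ _ uf); exists i.+1 => //.
    split; first by rewrite -ab1 nth_index.
    by apply: set_nth_default.
  have eE : index e (full u v) = i.+2 by rewrite index_uniq.
  have hC : c (u, v) / (M%:R - i.+1%:R * c (u, v)) <= C.
    rewrite -ab1 -(subcondE uv be).
    have -> : subcond (b, e) = cond subcond [:: (b, e)] by rewrite /cond big_seq1.
    apply: cond_subset => //; [exact: onward_uniq|exact: subcond_ge0|].
    move=> f; rewrite inE => /eqP ->; rewrite mem_onward /= eqxx (consecutive_adj uv be) /=.
    by apply/eqP => ea; move: eE; rewrite ea -/i => /eqP; rewrite -addn2 -[X in X == _]addn0 eqn_add2l.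
  by rewrite -ler_pdivrMr// subcond_den// (leq_ltn_trans iL).
(* At the end of the path the conductance is at least K / M, with K the total weight behind
   [(u, v)]; then [c <= K * (1 - c)] and [i + 1 <= M] conclude. *)
have bE : b = io v.
  by rewrite -(nth_index b bM) ab1 iE /= nth_rcons ltnn eqxx.
have hC : cond c (onward nb (u, v)) / M%:R <= C.
  pose s := [seq (b, first v w) | w <- nb v & w != u].
  have -> : cond c (onward nb (u, v)) / M%:R = cond subcond s.
    rewrite /cond !big_map mulr_suml big_seq [RHS]big_seq; apply: eq_bigr => w.
    by rewrite mem_filter => /andP[_ vw]; rewrite bE subcond_first.
  apply: cond_subset; [|exact: onward_uniq|exact: subcond_ge0|].
    rewrite map_inj_in_uniq ?filter_uniq// => w w'.
    rewrite !mem_filter => /andP[_ vw] /andP[_ vw'] [ww'].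
    have h1 := consecutive_first vw; have h2 := consecutive_first vw'.
    by rewrite -ww' in h2; have [] := edge_unique vw vw' h1 h2.
  move=> f /mapP[w]; rewrite mem_filter => /andP[wu vw] ->.
  have h1 := consecutive_first vw.
  rewrite mem_onward /= eqxx bE (consecutive_adj vw h1)/=.
  apply: contra wu => /eqP fa; rewrite fa -bE in h1.
  have h2 : consecutive b a (full v u) by rewrite full_rev// consecutive_rev.
  by have [_ ->] := edge_unique vw (sym uv) h1 h2.
have K0 := cond_ge0 csub (onward nb (u, v)).
have [_] := csub (u, v).
move: hC K0 d0 c0 c1; move: (cond c _) (c (u, v)) => K k hC K0 d0 c0 c1 hk.
have M0 : 0 < M%:R :> R by rewrite ltr0n (leq_ltn_trans _ LM).
rewrite ler_pdivrMr// in hC.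
have iM : i.+1%:R <= M%:R :> R by rewrite ler_nat iE.
apply: (@le_trans _ _ (C * (M%:R - M%:R * k))); last first.
  by rewrite ler_wpM2l// lerD2l lerN2 ler_wpM2r.
have : K * (1 - k) <= C * M%:R * (1 - k) by rewrite ler_wpM2r// subr_ge0 ltW.
nra.
Qed.

Lemma cond_subcond_pos u v : v \in nb u -> 0 < c (u, v) -> 0 < cond subcond (star nb' (io u)).
Proof.
move=> uv cpos; have M0 : 0 < M%:R :> R by rewrite ltr0n (leq_ltn_trans _ (pM uv)).
have : 0 < subcond (io u, first u v) by rewrite subcond_first// divr_gt0.
move/lt_le_trans; apply.
have -> : subcond (io u, first u v) = cond subcond [:: (io u, first u v)].
  by rewrite /cond big_seq1.
apply: cond_subset => //; [by rewrite map_inj_uniq// => y z []|exact: subcond_ge0|].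
move=> f; rewrite inE => /eqP ->; apply/mapP; exists (first u v) => //.
exact: consecutive_adj (consecutive_first uv).
Qed.

End SubCond.
End Subdivision.

(** * Conductances of a transient tree *)

Section Transience.
Variables (R : realType) (V : countType) (nb : V -> seq V).
Hypothesis nb_uniq : forall x, uniq (nb x).
Hypothesis nb_sym : forall x y, y \in nb x -> x \in nb y.
Hypothesis nb_conn : connected_graph nb.

(** * Hitting probabilities as a potential *)

Section Hitting.
Variable x0 : V.

Definition hitting N y : R := \sum_(n < N) hit_first nb R x0 n y.

Lemma hit_first_ge0 n y : 0 <= hit_first nb R x0 n y.
Proof.
elim: n y => [|n IH] y /=; case: ifP => // _.
by rewrite mulr_ge0 ?invr_ge0 ?sumr_ge0.
Qed.

Lemma hittingS N y : hitting N.+1 y =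
  if y == x0 then 1 else (deg nb y)%:R^-1 * \sum_(z <- nb y) hitting N z.
Proof.
rewrite /hitting big_ord_recl /=; case: eqP => _; first by rewrite big1 ?addr0.
by rewrite add0r -mulr_sumr exchange_big.
Qed.

Lemma hitting_ge0 N y : 0 <= hitting N y.
Proof. by apply: sumr_ge0 => i _; apply: hit_first_ge0. Qed.

Lemma hitting_le1 N y : hitting N y <= 1.
Proof.
elim: N y => [|N IH] y; first by rewrite /hitting big_ord0.
rewrite hittingS; case: ifP => // _; rewrite mulrC.
have [d0|d0] := posnP (deg nb y); first by rewrite d0 invr0 mulr0.
rewrite ler_pdivrMr ?ltr0n// mul1r /deg -sum1_size natr_sum.
by apply: ler_sum.
Qed.

Lemma hitting_nd y : nondecreasing_seq (fun N => hitting N y).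
Proof.
apply/nondecreasing_seqP => n; rewrite /hitting big_ord_recr /=.
by rewrite lerDl hit_first_ge0.
Qed.

Definition hprob y : R := limn (fun N => hitting N y).

Lemma hprob_cvg y : hitting N y @[N --> \oo] --> hprob y.
Proof.
apply: nondecreasing_is_cvgn; first exact: hitting_nd.
by exists 1 => _ [n _ <-]; apply: hitting_le1.
Qed.

Lemma hprob_ge0 y : 0 <= hprob y.
Proof.
apply: limr_ge; first by apply: cvgP; apply: hprob_cvg.
by near=> n; apply: hitting_ge0.
Unshelve. all: by end_near. Qed.

Lemma hprob_le1 y : hprob y <= 1.
Proof.
apply: limr_le; first by apply: cvgP; apply: hprob_cvg.
by near=> n; apply: hitting_le1.
Unshelve. all: by end_near. Qed.

Lemma sum_hitting_cvg (s : seq V) :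
  \sum_(z <- s) hitting N z @[N --> \oo] --> \sum_(z <- s) hprob z.
Proof.
elim: s => [|z s IH].
  by under eq_fun do rewrite big_nil; rewrite big_nil; exact: cvg_cst.
under eq_fun do rewrite big_cons.
by rewrite big_cons; apply: cvgD; [exact: hprob_cvg|exact: IH].
Qed.

Lemma hprobE y : hprob y =
  if y == x0 then 1 else (deg nb y)%:R^-1 * \sum_(z <- nb y) hprob z.
Proof.
have h2 : hitting N.+1 y @[N --> \oo] --> hprob y.
  by rewrite (cvg_shiftS (fun N => hitting N y)); apply: hprob_cvg.
apply: cvg_unique h2 _ => //.
rewrite (_ : (fun N => hitting N.+1 y) = fun N => if y == x0 then 1 else
  (deg nb y)%:R^-1 * \sum_(z <- nb y) hitting N z); last first.
  by apply/funext => N; rewrite hittingS.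
case: eqP => _; first exact: cvg_cst.
by apply: cvgM; [exact: cvg_cst|exact: sum_hitting_cvg].
Qed.

Lemma hprob_harm y : y != x0 -> \sum_(z <- nb y) hprob z = (deg nb y)%:R * hprob y.
Proof.
move=> yx; rewrite (hprobE y) (negbTE yx).
have [d0|d0] := posnP (deg nb y).
  by rewrite d0 mul0r (size0nil d0) big_nil.
by rewrite mulrA divff ?mul1r// pnatr_eq0 -lt0n.
Qed.

Lemma hprob_x0 : hprob x0 = 1.
Proof. by rewrite hprobE eqxx. Qed.

Lemma hprob_gt0 y : 0 < hprob y.
Proof.
have [q [qp <-]] := nb_conn x0 y.
elim/last_ind: q qp => [|q z IH]; first by rewrite /= hprob_x0.
rewrite rcons_path last_rcons => /andP[/IH h zq].
rewrite hprobE; case: ifP => // _.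
have qz : last x0 q \in nb z by apply: nb_sym.
have d0 : (0 < deg nb z)%N by rewrite /deg; case: (nb z) qz.
rewrite mulr_gt0 ?invr_gt0 ?ltr0n//.
rewrite (big_rem _ qz)/=; apply: ltr_pwDl => //.
by apply: sumr_ge0 => i _; apply: hprob_ge0.
Qed.

(** With [hprob] as voltage this is the current through a unit edge divided by the voltage at its
    tail; edges without a voltage drop get 0. *)
Definition srwcond (f : V * V) : R :=
  if f.2 \in nb f.1 then Num.max 0 ((hprob f.1 - hprob f.2) / hprob f.1) else 0.

Lemma srwcond_ge0 f : 0 <= srwcond f.
Proof. by rewrite /srwcond; case: ifP => // _; rewrite le_max lexx. Qed.

(** Write h for [hprob]. If the voltage drops from [y] to [z], then [z] is not [x0], and Kirchhoff's
    law at [z] puts weight at least r = (h y - h z) / h z behind the edge, whose own weight is r /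
    (1 + r). *)
Lemma subsolution_srwcond : subsolution (onward nb) srwcond.
Proof.
move=> [y z]; split; first exact: srwcond_ge0.
have C0 : 0 <= cond srwcond (onward nb (y, z)).
  by apply: sumr_ge0 => f _; apply: srwcond_ge0.
rewrite {1}/srwcond /=; case: ifP => [yz|_]; last by rewrite mul0r.
have hy := hprob_gt0 y; have hz := hprob_gt0 z.
have [hyz|hyz] := leP (hprob y) (hprob z).
  rewrite max_l ?mul0r// ler_pdivrMr// mul0r subr_le0//.
have zx0 : z != x0.
  by apply: contraTN hyz => /eqP ->; rewrite hprob_x0 -leNgt hprob_le1.
rewrite max_r; last by rewrite divr_ge0 ?subr_ge0// ltW.
have zy := nb_sym yz.
have hC : (hprob y - hprob z) / hprob z <= cond srwcond (onward nb (y, z)).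
  rewrite /cond /onward big_map big_filter /=.
  apply: (@le_trans _ _ (\sum_(w <- nb z | w != y) (hprob z - hprob w) / hprob z)); last first.
    rewrite big_seq_cond [leRHS]big_seq_cond ler_sum// => w /andP[zw _].
    by rewrite /srwcond zw le_max lexx orbT.
  rewrite -mulr_suml ler_wpM2r ?invr_ge0 ?(ltW hz)//.
  have := hprob_harm zx0; rewrite (bigD1_seq y)//= => hs.
  have hn : \sum_(w <- nb z | w != y) hprob z = (deg nb z)%:R * hprob z - hprob z.
    have : \sum_(w <- nb z) hprob z = (deg nb z)%:R * hprob z.
      by rewrite big_const_seq count_predT iter_addr_0 mulr_natl.
    by rewrite (bigD1_seq y)//= => <-; rewrite [X in _ = X - _]addrC addrK.
  by rewrite sumrB hn; lra.
move: hC C0; move: (cond _ _) => C hC C0.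
rewrite ler_pdivrMr// in hC.
rewrite mulrAC ler_pdivrMr//; lra.
Qed.

(** The return probability is the mean of [hprob] over the neighbours of [x0]; if it is below 1, the
    voltage drops along some edge. *)
Lemma srwcond_pos : nb x0 != [::] -> srw_transient_at nb R x0 ->
  0 < cond srwcond (star nb x0).
Proof.
move=> nb0 tr.
have d0 : (0 < deg nb x0)%N by rewrite /deg lt0n size_eq0.
have [z zx hz] : exists2 z, z \in nb x0 & hprob z < 1.
  apply: contrapT => h.
  have h1 z : z \in nb x0 -> hprob z = 1.
    move=> zx; apply/eqP; rewrite eq_le hprob_le1/= leNgt; apply/negP => hz.
    by apply: h; exists z.
  have hs (N : nat) : (((deg nb x0)%:R^-1 * \sum_(z <- nb x0) hitting N z)%:E <=
      \sum_(n <oo) (first_return nb R x0 n)%:E)%E.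
    apply: le_trans (nneseries_lim_ge N _); last first.
      move=> k _ _; rewrite lee_fin /first_return mulr_ge0 ?invr_ge0 ?sumr_ge0// => w _.
      exact: hit_first_ge0.
    rewrite sumEFin lee_fin /hitting exchange_big/= big_mkord mulr_sumr.
    by [].
  move: tr; rewrite /srw_transient_at; set S := (X in (X < 1)%E) in hs *; move=> S1.
  have S0 : (0 <= S)%E.
    apply: le_trans (hs 0%N); rewrite lee_fin mulr_ge0 ?invr_ge0 ?sumr_ge0// => w _.
    exact: hitting_ge0.
  have Sf : S \is a fin_num by rewrite ge0_fin_numE// (lt_trans S1)// ltry.
  have fS : fine S < 1 by rewrite -lte_fin fineK.
  have : (deg nb x0)%:R^-1 * \sum_(z <- nb x0) hprob z <= fine S.
    have hc : (deg nb x0)%:R^-1 * \sum_(z <- nb x0) hitting N z @[N --> \oo] -->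
       (deg nb x0)%:R^-1 * \sum_(z <- nb x0) hprob z.
      by apply: cvgM; [exact: cvg_cst|exact: sum_hitting_cvg].
    apply: ler_cvg_to hc (cvg_cst (fine S)) _; near=> N.
    by rewrite -lee_fin fineK//; exact: hs.
  rewrite big_seq (eq_bigr (fun=> 1)) -?big_seq; last by move=> z /h1.
  have -> : \sum_(i <- nb x0) 1 = (deg nb x0)%:R :> R by rewrite /deg -sum1_size natr_sum.
  rewrite mulVf; last by rewrite pnatr_eq0 -lt0n.
  by move=> /le_lt_trans /(_ fS); rewrite ltxx.
have hc : 0 < srwcond (x0, z).
  by rewrite /srwcond /= zx hprob_x0 divr1 lt_max subr_gt0 hz orbT.
apply: (lt_le_trans hc); rewrite /cond /star big_map (big_rem _ zx)/= lerDl.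
by apply: sumr_ge0 => w _; apply: srwcond_ge0.
Unshelve. all: by end_near. Qed.

End Hitting.

(** One iteration of the series law: it makes an edge positive as soon as something positive lies
    behind it. *)
Definition series_law (c : V * V -> R) f :=
  cond c (onward nb f) / (1 + cond c (onward nb f)).

Lemma le_series_law c f : subsolution (onward nb) c -> c f <= series_law c f.
Proof.
move=> csub; have [c0 h] := csub f; have C0 := cond_ge0 csub (onward nb f).
by rewrite ler_pdivlMr//; lra.
Qed.

Lemma subsolution_series c : subsolution (onward nb) c -> subsolution (onward nb) (series_law c).
Proof.
move=> csub f; have C0 := cond_ge0 csub (onward nb f).
split; first by rewrite divr_ge0// addr_ge0.
have h : cond c (onward nb f) <= cond (series_law c) (onward nb f).
  by apply: ler_sum => g _; apply: le_series_law.
rewrite mulrAC ler_pdivrMr; last by lra.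
by nra.
Qed.

Lemma cond_gt0 (c : V * V -> R) F : (forall f, 0 <= c f) ->
  0 < cond c F -> exists2 f, f \in F & 0 < c f.
Proof.
move=> c0 F0; apply: contrapT => h; move: F0; rewrite /cond big_seq big1 ?ltxx// => f fF.
apply/eqP; rewrite eq_le c0 andbT leNgt; apply/negP => cf; apply: h; by exists f.
Qed.

Lemma cond_mem_gt0 (c : V * V -> R) F f : (forall f, 0 <= c f) ->
  f \in F -> 0 < c f -> 0 < cond c F.
Proof.
move=> c0 fF cf; rewrite /cond (big_rem _ fF)/=; apply: ltr_pwDl => //.
by apply: sumr_ge0.
Qed.

(** Positivity moves along a path. If the positive edge at the old vertex does not lead to the new
    vertex [z], it lies behind the edge from [z] to the old vertex, and [series_law] applies; if it
    does, something positive lies behind it, at [z]. *)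
Lemma subsolution_everywhere x y :
  (exists2 c : V * V -> R, subsolution (onward nb) c & 0 < cond c (star nb y)) ->
  exists2 c : V * V -> R, subsolution (onward nb) c & 0 < cond c (star nb x).
Proof.
have [q [qp <-]] := nb_conn y x.
elim/last_ind: q qp => [|q z IH] //.
rewrite rcons_path last_rcons => /andP[/IH {}IH zq] /IH [c csub].
have sub0 f : 0 <= c f by case: (csub f).
case/(cond_gt0 sub0) => _ /mapP[w wq ->] cw.
have [wz|wz] := eqVneq w z; last first.
  exists (series_law c); first exact: subsolution_series.
  apply: (@cond_mem_gt0 _ _ (z, last y q)).
  - by move=> f; case: (subsolution_series csub f).
  - by apply/mapP; exists (last y q) => //; apply: nb_sym.
  rewrite divr_gt0//.
    by apply: (cond_mem_gt0 sub0 _ cw); rewrite mem_onward /= eqxx wq.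
  by rewrite ltr_pwDl// (cond_ge0 csub).
exists c => //; subst w.
have [_ h] := csub (last y q, z).
have C0 := cond_ge0 csub (onward nb (last y q, z)).
have : 0 < cond c (onward nb (last y q, z)) by nra.
case/(cond_gt0 sub0) => -[a b]; rewrite mem_onward /= => /and3P[/eqP -> bz _] cb.
by apply: (cond_mem_gt0 sub0 _ cb); apply/mapP; exists b.
Qed.

End Transience.

(** * The invariant along the walk, and the conclusion *)

Lemma lrep_lrun (V : countType) (nb : V -> seq V) x h :
  (forall x, uniq (nb x)) -> (forall x, x \notin nb x) ->
  (forall x y, y \in nb x -> x \in nb y) -> has_cuts nb ->
  exists S, lrep nb (lrun nb x h) S.
Proof.
move=> u i s cu; elim/last_ind: h => [|h e [S rp]].
  by exists [:: star nb x]; apply: lrep_start.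
rewrite /lrun foldl_rcons -/(lrun nb x h).
case: S rp => [|F S] rp.
  by case: rp => _ _; case: (rev _) => [|[]].
have [eo|eo] := boolP (e \in out_edges nb (cur (lrun nb x h))); last first.
  by exists (F :: S); rewrite /lstep (negbTE eo).
move: eo; rewrite (perm_mem (lrep_out rp)) mem_cat => /orP[|eF]; last first.
  by exists (push (onward nb) e F S); case: (lrep_push u i s cu rp eF).
move: rp; case: (lrun nb x h) => X0 p; case/lastP: p => // p [f X] rp.
rewrite /back /= rev_rcons inE => /eqP ->.
by exists (pop F S); case: (lrep_pop u rp).
Qed.

(* [dwell] takes rational values, hence does not depend on the model of the reals. *)
Lemma dwell_transfer (V : countType) (nb : V -> seq V) (R R' : realType) j st :
  (forall e : R, 0 < e -> exists i, forall m, dwell nb R j i m st <= e) ->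
  forall e : R', 0 < e -> exists i, forall m, dwell nb R' j i m st <= e.
Proof.
move=> h e e0; pose k := Num.truncn e^-1.
have [|i hi] := h (ratr (k.+1%:R^-1)); first by rewrite ltr0q invr_gt0 ltr0n.
exists i => m; apply: (@le_trans _ _ (ratr (k.+1%:R^-1))).
  by have := hi m; rewrite (dwell_ratr nb R) (dwell_ratr nb R') !ler_rat.
rewrite fmorphV rmorph_nat/= invf_ple ?posrE//.
by rewrite ltW// truncnS_gt.
Qed.

Theorem mainTheorem2 (R : realType) (V V' : countType) (nb : V -> seq V) (nb' : V' -> seq V') :
  is_tree nb ->
  infinite_vertex_set V ->
  srw_transient nb R ->
  (forall v : V, deg nb v <> 2%N) ->
  lf_graph nb' ->
  bounded_subdivision nb nb' ->
  forall x : V', lcrw_transient_at nb' x.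
Proof.
move=> [[u irr sym conn] acy] inf [x0 tr] _ [u' irr' sym' conn'] [io [p [sd [L hL]]]] x.
have cuts' := subdivision_cuts irr sd (acyclic_cuts irr sym acy).
(* Another vertex exists and is connected to [x0], which therefore has a neighbour. *)
have nb0 : nb x0 != [::].
  have [v vx] := inf [:: x0]; have [q [qp qv]] := conn x0 v.
  case: q qp qv vx => [_ <-|y q /= /andP[yx _] _ _]; first by rewrite /= inE eqxx.
  by apply/eqP => E; rewrite /adj E in yx.
have csub := @subsolution_srwcond R _ _ u sym conn x0.
have pM a b : b \in nb a -> (size (p a b) < L.+1)%N by move/hL; rewrite ltnS.
have csub' := subsolution_subcond irr sym u sd csub pM u'.
have [c c_sub c_pos] : exists2 c : V' * V' -> R, subsolution (onward nb') c & 0 < cond c (star nb' x).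
  apply: (@subsolution_everywhere R _ nb' sym' conn' x (io x0)).
  exists (subcond nb io p (srwcond R nb x0) L.+1) => //.
  have := srwcond_pos nb0 tr.
  case/(cond_gt0 (@srwcond_ge0 R V nb x0)) => _ /mapP[v vx ->] cv.
  exact: (cond_subcond_pos irr sd csub pM u' vx cv).
move=> d Omega R' P cc lc; apply: (lcrw_converges lc).
  move=> j h e j0 e0; have [S rp] := lrep_lrun x h u' irr' sym' cuts'.
  exact: (dwell_small_pos u' irr' sym' cuts' j0 rp e0).
(* The conductances take values in [R], the probability in [R']. *)
apply: dwell_transfer => e e0.
exact: (dwell_small_root u' irr' sym' cuts' c_sub c_pos e0).
Qed.
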